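(* Let $T_\lambda $ be a homogeneous conformal averaging operator on a semisimple finite-dimensional Lie algebra $\mathfrak g$ over $\mathbb C$. Then $T_*(\mathfrak g)=\mathfrak g_0\oplus Z$ is a reductive Lie algebra, where $\mathfrak g_0$ is semisimple and $Z$ is the center of $T_*(\mathfrak g)$, and $\mathfrak g_0\subseteq T_*(T_*(\mathfrak g))$.
   Context: All spaces are over $\mathbb C$. A conformal averaging operator on a Lie algebra $\mathfrak g$ is a linear map $T_\lambda:\mathfrak g\to\mathfrak g[\lambda]$ ($\lambda,\mu$ formal variables) such that $$T_{\lambda+\mu}([T_\lambda (x),y]) = [T_\lambda (x), T_\mu(y)] \in \mathfrak g[\lambda, \mu ]\quad\text{for all }x,y\in\mathfrak g,$$ where maps and brackets are extended linearly in the polynomial variables. For a subspace $B\subseteq\mathfrak g$, $T_*(B)$ denotes the linear span of all $T_\alpha(b)$, $b\in B$, $\alpha\in\mathbb C$ ($T_\alpha(b)$ is the value of the polynomial $T_\lambda(b)$ at $\lambda=\alpha$); equivalently, the span of all coefficients of the polynomials $T_\lambda(b)$, $b\in B$. The space $T_*(\mathfrak g)$ is a Lie subalgebra of $\mathfrak g$. For $\mathfrak g$ semisimple, $T_\lambda$ is called homogeneous if $T_*(\mathfrak g)$ contains a Cartan subalgebra of $\mathfrak g$. *)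

(* Defs.v *)
From HB Require Import structures.
From mathcomp Require Import all_boot all_order all_algebra.
From mathcomp Require Import finmap monalg complex.
From mathcomp Require Import boolp classical_sets reals.

Set Implicit Arguments.
Unset Strict Implicit.
Unset Printing Implicit Defensive.

Import GRing.Theory.
Local Open Scope ring_scope.

HB.mixin Record Lmodule_isLie (K : fieldType) L of GRing.Lmodule K L := {
  lie : L -> L -> L;
  lie_linearl : forall y : L, linear (fun x => lie x y);
  lie_linearr : forall x : L, linear (fun y => lie x y);
  liexx : forall x : L, lie x x = 0;
  lie_jacobi : forall x y z : L,
    lie x (lie y z) + lie y (lie z x) + lie z (lie x y) = 0
}.

#[short(type="lieAlgType")]
HB.structure Definition LieAlg (K : fieldType) :=
  {L of Lmodule_isLie K L & GRing.Lmodule K L}.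

#[short(type="vectLieType")]
HB.structure Definition VectLie (K : fieldType) :=
  {L of LieAlg K L & Vector K L}.

(* Polynomials with coefficients in a module V and exponents in I.  They are   *)
(* {malg V[I]} under an alias, because {malg V[I]} has a canonical scaling     *)
(* only when V is the ring of scalars itself.                                  *)
Definition vpoly (I : choiceType) (V : zmodType) : Type := {malg V[I]}.

HB.instance Definition _ (I : choiceType) (V : zmodType) :=
  GRing.Zmodule.on (vpoly I V).

Notation vpoly1 V := (vpoly nat V).
(* The exponent (i, j) stands for lambda^i mu^j.                               *)
Notation vpoly2 V := (vpoly (nat * nat)%type V).

Section VPolyLmodule.
Context (I : choiceType) (K : fieldType) (V : lmodType K).
Implicit Types (c : K) (p : vpoly I V).

Definition vpoly_scale c p : vpoly I V :=
  \sum_(k <- msupp p) << c *: p@_k *g k >>.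

Lemma mcoeff_vpoly_scale c p k : (vpoly_scale c p)@_k = c *: p@_k.
Proof.
rewrite /vpoly_scale raddf_sum /=.
have [kp|kp] := boolP (k \in msupp p).
  rewrite (big_fsetD1 _ kp) /= mcoeffU eqxx mulr1n big1_fset ?addr0 // => j.
  by rewrite in_fsetD1 => /andP[/negPf jk _] _; rewrite mcoeffU jk.
rewrite mcoeff_outdom // scaler0 big1_fset // => j jp _.
by rewrite mcoeffU; case: eqP => // jk; rewrite -jk jp in kp.
Qed.

Fact vpoly_scaleA c d p :
  vpoly_scale c (vpoly_scale d p) = vpoly_scale (c * d) p.
Proof. by apply/malgP => k; rewrite !mcoeff_vpoly_scale scalerA. Qed.

Fact vpoly_scale1 : left_id 1 vpoly_scale.
Proof. by move=> p; apply/malgP => k; rewrite mcoeff_vpoly_scale scale1r. Qed.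

Fact vpoly_scaleDr : right_distributive vpoly_scale +%R.
Proof.
move=> c p q; apply/malgP => k.
by rewrite mcoeffD !mcoeff_vpoly_scale mcoeffD scalerDr.
Qed.

Fact vpoly_scaleDl p : {morph vpoly_scale^~ p : c d / c + d}.
Proof.
move=> c d; apply/malgP => k.
by rewrite mcoeffD !mcoeff_vpoly_scale scalerDl.
Qed.

HB.instance Definition _ := GRing.Zmodule_isLmodule.Build K (vpoly I V)
  vpoly_scaleA vpoly_scale1 vpoly_scaleDr vpoly_scaleDl.

Lemma mcoeff_vpolyZ c p k : (c *: p)@_k = c *: p@_k.
Proof. exact: mcoeff_vpoly_scale. Qed.

End VPolyLmodule.

Section VPolyOps.
Context (K : fieldType) (V : lmodType K).

(* p(lambda) |-> p(a), for a scalar a.                                         *)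
Definition veval (p : vpoly1 V) (a : K) : V :=
  \sum_(n <- msupp p) a ^+ n *: p@_n.

(* p(lambda) |-> p(lambda + mu).                                               *)
Definition vsubst_add (p : vpoly1 V) : vpoly2 V :=
  \sum_(n <- msupp p) \sum_(k < n.+1)
     << p@_n *+ 'C(n, k) *g (k : nat, n - k)%N >>.

(* p(lambda, mu) |-> lambda^i p(lambda, mu).                                   *)
Definition vmulXl (i : nat) (p : vpoly2 V) : vpoly2 V :=
  \sum_(m <- msupp p) << p@_m *g (i + m.1, m.2)%N >>.

End VPolyOps.

(* Left-hand side: T_{lambda+mu}([T_lambda x, y]), where T_{lambda+mu} acts on *)
(* the coefficients of the powers of lambda; right-hand side:                  *)
(* [T_lambda x, T_mu y].                                                       *)
Definition conformal_averaging (K : fieldType) (g : lieAlgType K)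
    (T : {linear g -> vpoly1 g}) : Prop :=
  forall x y : g,
    \sum_(i <- msupp (T x)) vmulXl i (vsubst_add (T (lie (T x)@_i y)))
  = \sum_(i <- msupp (T x)) \sum_(j <- msupp (T y))
      (<< lie (T x)@_i (T y)@_j *g (i, j) >> : vpoly2 g).

Section LinearSpan.
Context (K : fieldType) (V : vectType K).

(* The linear span of an arbitrary set: the smallest subspace containing it.   *)
Definition lspan (S : set V) : {vspace V} :=
  xget 0%VS [set W : {vspace V} |
    (forall v, S v -> v \in W) /\
    (forall W' : {vspace V}, (forall v, S v -> v \in W') -> (W <= W')%VS)].

Lemma lspan_seq (S : set V) :
  exists2 s : seq V, (forall v, v \in s -> S v) &
    lspan S = <<s>>%VS /\ (forall v, S v -> v \in lspan S).
Proof.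
pose P n := `[< exists2 s : seq V, (forall v, v \in s -> S v) & \dim <<s>> = n >].
have exP : exists n, P n.
  by exists (\dim <<[::] : seq V>>); apply/asboolP; exists [::].
have ubP n : P n -> (n <= \dim {:V})%N.
  by move=> /asboolP[s _ <-]; apply/dimvS/subvf.
case: (ex_maxnP exP ubP) => n /asboolP[s sS sn] nmax.
exists s => //; rewrite /lspan.
set Q := (X in xget _ X).
have Sgen v : S v -> v \in <<s>>%VS.
  move=> Sv; apply: contraT => vs.
  have : P (\dim <<v :: s>>).
    apply/asboolP; exists (v :: s) => // w.
    by rewrite inE => /orP[/eqP->//|/sS].
  move=> /nmax; rewrite -sn leqNgt => /negP[].
  rewrite ltnNge; apply: contra vs => le.
  have sub : (<<s>> <= <<v :: s>>)%VS.
    by apply: sub_span => w ws; rewrite inE ws orbT.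
  have /eqP -> : <<s>>%VS == <<v :: s>>%VS.
    by rewrite eqEdim sub.
  by apply: memv_span; rewrite mem_head.
have Qs : Q <<s>>%VS by split=> // W' SW'; apply/span_subvP => w /sS/SW'.
have [g1 l1] : Q (xget 0%VS Q) by apply: xgetPex; exists <<s>>%VS.
by split=> //; apply/eqP; rewrite eqEsubv (l1 _ Sgen) (Qs.2 _ g1).
Qed.

Lemma mem_lspan (S : set V) v : S v -> v \in lspan S.
Proof. by case: (lspan_seq S) => s _ [_]; apply. Qed.

Lemma lspan_subvP (S : set V) (W : {vspace V}) :
  (lspan S <= W)%VS <-> (forall v, S v -> v \in W).
Proof.
split=> [/subvP SW v /mem_lspan/SW //|SW].
case: (lspan_seq S) => s sS [-> _].
by apply/span_subvP => v /sS/SW.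
Qed.

End LinearSpan.

Definition Tstar (K : fieldType) (g : vectLieType K)
    (T : {linear g -> vpoly1 g}) (B : {vspace g}) : {vspace g} :=
  lspan [set v | exists (a : K) (b : g), b \in B /\ v = veval (T b) a].

(* Subalgebras of g are subspaces; the notions below are those of A as a Lie   *)
(* algebra in its own right, so that {:g}%VS stands for g itself.              *)
Section LieSubspaces.
Context (K : fieldType) (g : vectLieType K).
Implicit Types (A B H I : {vspace g}).

Definition subalgebra A : Prop :=
  forall x y, x \in A -> y \in A -> lie x y \in A.

Definition lie_ideal A I : Prop :=
  (I <= A)%VS /\ (forall x y, x \in A -> y \in I -> lie x y \in I).

Definition lie_span A B : {vspace g} :=
  lspan [set v | exists x y, [/\ x \in A, y \in B & v = lie x y]].

Definition derived_series (n : nat) A : {vspace g} :=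
  iter n (fun B => lie_span B B) A.

Definition lower_central (n : nat) A : {vspace g} := iter n (lie_span A) A.

Definition lie_solvable A : Prop := exists n, derived_series n A = 0%VS.

Definition lie_nilpotent A : Prop := exists n, lower_central n A = 0%VS.

(* The radical is zero; in particular the zero algebra is semisimple.          *)
Definition lie_semisimple A : Prop :=
  subalgebra A /\ (forall I, lie_ideal A I -> lie_solvable I -> I = 0%VS).

Definition lie_center A : {vspace g} :=
  lspan [set z | z \in A /\ (forall x, x \in A -> lie z x = 0)].

Lemma mem_lie_center A z :
  z \in lie_center A <-> z \in A /\ (forall x, x \in A -> lie z x = 0).
Proof.
split=> [|zA]; last exact: mem_lspan.
case: (lspan_seq [set z | z \in A /\ (forall x, x \in A -> lie z x = 0)]).
rewrite /lie_center => s sC [-> _] /(coord_span (X := in_tuple s)) ->.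
have nthC (i : 'I_(size s)) : s`_i \in A /\ (forall x, x \in A -> lie s`_i x = 0).
  by apply: sC; rewrite mem_nth.
split=> [|x xA]; first by apply: memv_suml => i _; apply/memvZ/(nthC i).1.
elim/big_ind: _ => [|u v u0 v0|i _].
- by have := lie_linearl x (-1) 0 0; rewrite /= !scaleN1r !addNr.
- by have := lie_linearl x 1 u v; rewrite /= !scale1r u0 v0 addr0.
- have l0 : lie (0 : g) x = 0.
    by have := lie_linearl x (-1) 0 0; rewrite /= !scaleN1r !addNr.
  have := lie_linearl x (coord (in_tuple s) i z) s`_i 0.
  by rewrite /= l0 !addr0 (nthC i).2 // scaler0.
Qed.

(* The radical equals the center.                                              *)
Definition lie_reductive A : Prop :=
  subalgebra A /\
  (forall I, lie_ideal A I -> lie_solvable I -> (I <= lie_center A)%VS).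

Definition cartan_subalgebra H : Prop :=
  [/\ subalgebra H, lie_nilpotent H &
      forall x, (forall h, h \in H -> lie x h \in H) -> x \in H].

Definition homogeneous (T : {linear g -> vpoly1 g}) : Prop :=
  exists2 H : {vspace g}, cartan_subalgebra H & (H <= Tstar T {:g})%VS.

End LieSubspaces.

(* Main.v *)
From HB Require Import structures.
Require Import Defs.
From mathcomp Require Import all_boot all_order all_algebra.
From mathcomp Require Import finmap monalg complex.
From mathcomp Require Import boolp classical_sets reals.
From mathcomp Require Import zify ring.

(* Fix a Cartan subalgebra H inside A = T_*(g) and write T_lambda as the sum    *)
(* of the lambda^m t_m.  The averaging identity reads                          *)
(*   [t_p x, t_j y] = sum_(i <= p) binom(p-i+j, p-i) t_(p-i+j) [t_i x, y].     *)
(* Descending induction on m >= 1 shows that t_m(g) lies in H and is           *)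
(* centralized by A and that t_m kills [A, g]: once this holds beyond m, t_m   *)
(* commutes with ad A, hence preserves root spaces, and the identity with      *)
(* (p, j) = (m+1, m-1) gives t_m [t_m x, y] = 0 for y in A, so that t_m, being *)
(* scalar on each root space, vanishes there.  Thus t_0 commutes with ad A     *)
(* too; it is nonzero on a root space exactly when this root space lies in A,  *)
(* and evaluating t_0 on [[e, f], e] shows that the roots of A are stable      *)
(* under opposite.  Hence the Killing form of g is nondegenerate on A, a       *)
(* solvable ideal of A contains no root vector, and A = [A, A] + Z(A) with     *)
(* [A, A] spanned by root vectors and coroots of A, which t_0 rescales.        *)
(* The roots of g relative to H are encoded as the eigenvalues of ad h0 for a  *)
(* single generic element h0 of H.                                             *)

(** The overview above relies on the root space decomposition of [g], obtained here from generalized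
    eigenspaces and traces. A generic [h0] in H separates the weights ([cartan_weights]), and by
    Engel's theorem its zero generalized eigenspace is H itself ([cartan_root_data]). Commutators
    have trace 0 on root strings, so at [x, y], with x and y in opposite root spaces, all weights
    are real multiples of one value ([string_wt]). Hence a perfect ideal in the radical of the
    Killing form would act nilpotently, and [killing_nondeg] follows. Nondegeneracy makes H abelian
    and the root spaces lines ([cartan_abelian], [root_pair]).

    The averaging identity enters as [averaging_coef] and confines t_m for m >= 1 ([coef_central]).
    The root vectors of A then come from t_0 alone ([coef0_neq0]), and the roots of A are symmetric
    ([Tstar_full_opp]), so the Killing form of [g] is nondegenerate on A ([killing_Tstar_nondeg]).

    Take g_0 = [A, A]. By invariance its orthogonal in A is central. A central element of g_0 has
    nilpotent adjoint action, so it is orthogonal to A and vanishes. A dimension count gives A = g_0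
    + Z. A solvable ideal of A lies in H and is central ([solvable_ideal_central]), whence
    reductivity and the semisimplicity of g_0. Finally t_0 rescales the root vectors of A, and
    [y, t_0 x] = t_0 [y, x] carries this to coroots ([derived_sub_TstarTstar]). *)

Set Implicit Arguments.
Unset Strict Implicit.
Unset Printing Implicit Defensive.

Import Order.TTheory GRing.Theory Num.Theory.
Local Open Scope ring_scope.

(** * Generalized eigenspaces and traces on stable subspaces *)

Section LinearAlgebra.
Context (K : fieldType) (V : vectType K).
Implicit Types (f h : 'End(V)) (U W : {vspace V}) (c : K).

(** Turns a linear condition into a [{vspace V}]; most subspaces below that are cut out by a
    condition are introduced this way. *)
Lemma mem_lspan_closed (S : set V) v :
  S 0 -> (forall a u w, S u -> S w -> S (a *: u + w)) -> v \in lspan S <-> S v.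
Proof.
move=> S0 SD; split=> [|Sv]; last exact: mem_lspan.
case: (lspan_seq S) => s sS [-> _] /(coord_span (X := in_tuple s)) ->.
elim/big_ind: _ => [//|u w Su Sw|i _].
  by rewrite -[u]scale1r; apply: SD.
by rewrite -[_ *: _]addr0; apply: SD => //; apply/sS/mem_nth.
Qed.

Lemma sum_subvP (I : eqType) (s : seq I) (F : I -> {vspace V}) W :
  (forall i, i \in s -> (F i <= W)%VS) -> (\sum_(i <- s) F i <= W)%VS.
Proof.
elim: s => [|i s IHs] sW; first by rewrite big_nil sub0v.
rewrite big_cons subv_add sW ?mem_head //= IHs // => j js.
by rewrite sW // inE js orbT.
Qed.

Lemma subv_sum_mem (I : eqType) (s : seq I) (F : I -> {vspace V}) i :
  i \in s -> (F i <= \sum_(j <- s) F j)%VS.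
Proof.
elim: s => [//|j s IHs]; rewrite inE big_cons => /orP[/eqP->|/IHs is_].
  exact: addvSl.
exact: subv_trans is_ (addvSr _ _).
Qed.

Lemma mem_sum_seq (I : eqType) (s : seq I) (F : I -> {vspace V}) x :
  uniq s -> x \in (\sum_(i <- s) F i)%VS ->
  exists2 y : I -> V, (forall i, y i \in F i) & x = \sum_(i <- s) y i.
Proof.
elim: s x => [|i s IHs] x.
  by rewrite big_nil memv0 => _ /eqP->; exists (fun=> 0) => [j|]; rewrite ?mem0v ?big_nil.
rewrite /= big_cons => /andP[is_ us] /memv_addP[u uF [w /(IHs _ us)[y yF ->] ->]].
exists (fun j => if j == i then u else y j) => [j|].
  by case: eqP => [->|].
rewrite big_cons eqxx; congr (_ + _); apply: eq_big_seq => j js.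
by case: eqP => // ji; rewrite -ji js in is_.
Qed.

Definition lpow f n : 'End(V) := iter n (comp_lfun f) \1%VF.

Lemma lpowE f n x : lpow f n x = iter n f x.
Proof. by elim: n => [|n IHn]; rewrite /= ?id_lfunE // comp_lfunE IHn. Qed.

Lemma iter_lfun0 f n : iter n f 0 = 0.
Proof. by rewrite -lpowE linear0. Qed.

Lemma iter_lfunD f n x y : iter n f (x + y) = iter n f x + iter n f y.
Proof. by rewrite -!lpowE linearD. Qed.

Lemma iter_lfunZ f n c x : iter n f (c *: x) = c *: iter n f x.
Proof. by rewrite -!lpowE linearZ. Qed.

Lemma iter_lfun_sum f n (I : Type) (s : seq I) (F : I -> V) :
  iter n f (\sum_(i <- s) F i) = \sum_(i <- s) iter n f (F i).
Proof. by rewrite -lpowE linear_sum; apply: eq_bigr => i _ /=; rewrite lpowE. Qed.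

Lemma iter_lfun_eq0 f n m x : (n <= m)%N -> iter n f x = 0 -> iter m f x = 0.
Proof. by move=> /subnK <-; rewrite iterD => ->; apply: iter_lfun0. Qed.

Lemma iter_comm f h n x :
  (forall y, f (h y) = h (f y)) -> f (iter n h x) = iter n h (f x).
Proof. by move=> fh; elim: n => //= n <-. Qed.

Lemma shiftE f c x : (f - c *: \1)%VF x = f x - c *: x.
Proof. by rewrite !lfun_simp. Qed.

Lemma shiftC f c x : f ((f - c *: \1)%VF x) = (f - c *: \1)%VF (f x).
Proof. by rewrite !shiftE raddfB /= linearZ. Qed.

Definition stablev f U := forall x, x \in U -> f x \in U.

Lemma stablev_iter f U n x : stablev f U -> x \in U -> iter n f x \in U.
Proof. by move=> fU xU; elim: n => //= n /fU. Qed.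

Lemma stablev_shift f U c : stablev f U -> stablev (f - c *: \1%VF) U.
Proof.
by move=> fU x xU; rewrite shiftE memvB ?memvZ ?fU.
Qed.

(* The generalized eigenspace of [f]; no bound on the exponent is imposed. *)
Definition geig f c : {vspace V} :=
  lspan [set x | exists n, iter n (f - c *: \1%VF)%VF x = 0].

Lemma mem_geig f c x :
  x \in geig f c <-> exists n, iter n (f - c *: \1%VF)%VF x = 0.
Proof.
apply: (mem_lspan_closed (S := [set x | exists n, iter n (f - c *: \1%VF)%VF x = 0])).
  by exists 0%N.
move=> a u w [n n0] [m m0]; exists (maxn n m).
by rewrite iter_lfunD iter_lfunZ !(iter_lfun_eq0 _ n0, iter_lfun_eq0 _ m0)
   ?leq_maxl ?leq_maxr // scaler0 addr0.
Qed.

Lemma geig_stable f c : stablev f (geig f c).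
Proof.
move=> x /mem_geig[n xn]; apply/mem_geig; exists n.
by rewrite -iter_comm ?xn ?linear0 // => y; apply: shiftC.
Qed.

(** Induction on the exponent reduces to a true eigenvector for c, on which (f - d)^m acts as (c -
    d)^m. *)
Lemma geig_disjoint f c d x : c != d -> x \in geig f c -> x \in geig f d -> x = 0.
Proof.
move=> cd /mem_geig[n]; elim: n x => [|n IHn] x //.
rewrite iterSr => xn xd.
have fx0 : (f - c *: \1%VF)%VF x = 0.
  by apply: IHn => //; apply: stablev_shift xd; apply: geig_stable.
have fx : f x = c *: x.
  by apply/eqP; rewrite -subr_eq0 -fx0 shiftE.
have [m] := (mem_geig f d x).1 xd.
have -> : iter m (f - d *: \1%VF)%VF x = (c - d) ^+ m *: x.
  elim: m => [|m /= ->]; first by rewrite scale1r.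
  by rewrite linearZ /= shiftE fx -scalerBl scalerA -exprSr.
by move/eqP; rewrite scaler_eq0 expf_eq0 subr_eq0 (negPf cd) andbF => /eqP.
Qed.

(** A power of f - c kills the first term; by induction it kills each of the others, which then lie
    in two generalized eigenspaces at once. *)
Lemma geig_indep f (s : seq K) (x : K -> V) :
  uniq s -> (forall c, c \in s -> x c \in geig f c) -> \sum_(c <- s) x c = 0 ->
  forall c, c \in s -> x c = 0.
Proof.
elim: s x => [//|c s IHs] x /= /andP[cs us] xE; rewrite big_cons => sum0.
have sE d : d \in s -> x d \in geig f d by move=> ds; apply: xE; rewrite inE ds orbT.
have [n xcn] := (mem_geig f c _).1 (xE c (mem_head _ _)).
have xs0 : forall d, d \in s -> x d = 0.
  move=> d ds; have := congr1 (iter n (f - c *: \1%VF)%VF) sum0.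
  rewrite iter_lfunD xcn add0r iter_lfun0 iter_lfun_sum => sum0'.
  have x'0 := IHs _ us _ sum0' d ds.
  apply: (@geig_disjoint f c d); last exact: sE.
    by apply: contraNneq cs => ->.
  apply/mem_geig; exists n; apply: x'0 => e es.
  by apply: stablev_iter (sE e es); apply/stablev_shift/geig_stable.
move=> d; rewrite inE => /orP[/eqP->|/xs0//].
by move: sum0; rewrite big_seq big1 ?addr0 // => e /xs0.
Qed.

Lemma geig_sum_disjoint f (s : seq K) c x :
  uniq s -> c \notin s -> x \in geig f c -> x \in (\sum_(d <- s) geig f d)%VS -> x = 0.
Proof.
move=> us cs xc /(mem_sum_seq us)[y yE xE].
pose z d := if d == c then x else - y d.
have zs d : d \in s -> z d = - y d.
  by rewrite /z; case: eqP => // -> cs'; rewrite cs' in cs.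
have -> : x = z c by rewrite /z eqxx.
apply: (@geig_indep f (c :: s)) (mem_head _ _); first by rewrite /= cs.
  by move=> d _; rewrite /z; case: eqP => [->//|_]; rewrite memvN.
rewrite big_cons big_seq (eq_bigr _ zs) -big_seq sumrN /z eqxx -xE subrr //.
Qed.

Lemma nilp_uniform h U :
  (forall x, x \in U -> exists n, iter n h x = 0) ->
  exists n, forall x, x \in U -> iter n h x = 0.
Proof.
move=> hU.
have : exists n, forall x, x \in (vbasis U : seq V) -> iter n h x = 0.
  have : forall x, x \in (vbasis U : seq V) -> exists n, iter n h x = 0.
    by move=> x /vbasis_mem/hU.
  elim: (vbasis U : seq V) => [|x s IHs] sn; first by exists 0%N.
  have [n xn] := sn x (mem_head _ _).
  have [|m ms] := IHs; first by move=> y ys; apply: sn; rewrite inE ys orbT.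
  exists (maxn n m) => y; rewrite inE => /orP[/eqP->|/ms yn].
    by apply: iter_lfun_eq0 xn; rewrite leq_maxl.
  by apply: iter_lfun_eq0 yn; rewrite leq_maxr.
case=> n sn; exists n => x xU; rewrite -lpowE.
have /subvP/(_ x xU) : (U <= lker (lpow h n))%VS.
  rewrite -(span_basis (vbasisP U)); apply/span_subvP => y ys.
  by rewrite memv_ker lpowE sn.
by rewrite memv_ker => /eqP.
Qed.

(** Fitting decomposition: n is chosen to annihilate the whole generalized eigenspace, so that this
    space is the kernel of F and rank-nullity on [U] applies. *)
Lemma fitting f U c : stablev f U ->
  exists n, let F := lpow (f - c *: \1%VF)%VF n in
  [/\ (U <= U :&: geig f c + F @: U)%VS, stablev f (F @: U) &
     (\dim (U :&: geig f c) + \dim (F @: U) = \dim U)%N].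
Proof.
move=> fU; have [x|n nE] := @nilp_uniform (f - c *: \1%VF)%VF (geig f c).
  by move/mem_geig.
exists n => F.
have kerF : lker F = geig f c.
  apply/vspaceP => x; rewrite memv_ker lpowE; apply/eqP/idP => [xn|/nE//].
  by apply/mem_geig; exists n.
have dimE : (\dim (U :&: geig f c) + \dim (F @: U) = \dim U)%N.
  by rewrite -kerF limg_ker_dim.
have FU : (F @: U <= U)%VS.
  apply/subvP => _ /memv_imgP[x xU ->]; rewrite lpowE.
  by apply: stablev_iter => //; apply: stablev_shift.
split=> //; last first.
  move=> _ /memv_imgP[x xU ->]; apply/memv_imgP; exists (f x); first exact: fU.
  by rewrite !lpowE; apply: iter_comm => y; apply: shiftC.
have dis : (U :&: geig f c :&: F @: U = 0)%VS.
  apply/vspaceP => x; rewrite memv0; apply/idP/eqP => [|->]; last by rewrite mem0v.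
  rewrite !memv_cap => /andP[/andP[_ /mem_geig[m xm]] /memv_imgP[y yU xF]].
  have : y \in geig f c.
    by apply/mem_geig; exists (m + n)%N; rewrite iterD -[iter n _ y]lpowE -xF.
  by rewrite xF lpowE => /nE.
have /eqP UE : (U :&: geig f c + F @: U)%VS == U.
  by rewrite eqEdim subv_add capvSl FU /= (dimv_disjoint_sum dis) dimE.
by rewrite UE.
Qed.

End LinearAlgebra.

Section Spectrum.
Context (K : closedFieldType) (V : vectType K).
Implicit Types (f h : 'End(V)) (U W : {vspace V}) (c : K).

Lemma stablev_eigenvector f U : stablev f U -> U != 0%VS ->
  exists c x, [/\ x \in U, x != 0 & f x = c *: x].
Proof.
move=> fU U0.
have U1 : (0 < \dim U)%N by rewrite lt0n dimv_eq0.
pose M : 'M_(\dim U) := \matrix_i \row_j coord (vbasis U) j (f (vbasis U)`_i).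
have [c rc] : exists c, root (char_poly M) c.
  apply/closed_rootP; rewrite size_char_poly; lia.
move: rc; rewrite -eigenvalue_root_char => /eigenvalueP[v vM v0].
exists c, (\sum_i v 0 i *: (vbasis U)`_i).
have bU i : (vbasis U)`_i \in U \/ (\dim U <= i)%N.
  case: (ltnP i (\dim U)) => [lt|]; last by right.
  by left; apply: vbasis_mem; rewrite mem_nth // size_tuple.
have bU' (i : 'I_(\dim U)) : (vbasis U)`_i \in U.
  by case: (bU i) => // ; rewrite leqNgt ltn_ord.
split.
- by apply: memv_suml => i _; rewrite memvZ.
- apply: contra_neq v0 => s0; apply/rowP => i; rewrite mxE.
  have fr := basis_free (vbasisP U).
  by have := coord_sum_free (fun i => v 0 i) i fr; rewrite s0 linear0.
- rewrite linear_sum /= scaler_sumr.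
  under eq_bigr => i _ do rewrite linearZ /= (coord_vbasis (fU _ (bU' i))) scaler_sumr.
  rewrite exchange_big /=; apply: eq_bigr => j _.
  have := congr1 (fun w : 'rV_(\dim U) => w 0 j) vM; rewrite !mxE => E.
  rewrite scalerA -E scaler_suml; apply: eq_bigr => i _.
  by rewrite scalerA !mxE.
Qed.

Lemma stablev_geig_sum f U : stablev f U ->
  exists s : seq K, (U <= \sum_(c <- s) (U :&: geig f c))%VS.
Proof.
have [n leUn] := ubnP (\dim U); elim: n => // n IHn in U leUn *.
move=> fU; have [->|U0] := eqVneq U 0%VS; first by exists [::]; rewrite sub0v.
have [c [x [xU x0 fx]]] := stablev_eigenvector fU U0.
have [m /= [UF fF dimF]] := fitting c fU; set F := lpow _ _ in UF fF dimF.
have FU : (F @: U <= U)%VS.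
  apply/subvP => _ /memv_imgP[y yU ->]; rewrite lpowE.
  by apply: stablev_iter => //; apply: stablev_shift.
have Ex : x \in (U :&: geig f c)%VS.
  rewrite memv_cap xU; apply/mem_geig; exists 1%N.
  by rewrite /= shiftE fx subrr.
have d0 : (0 < \dim (U :&: geig f c))%N.
  rewrite lt0n dimv_eq0; apply: contraNneq x0 => E.
  by move: Ex; rewrite E memv0.
have [|s sF] := IHn (F @: U)%VS _ fF; first by lia.
exists (c :: s); apply: subv_trans UF _; rewrite big_cons addvS //.
apply: subv_trans sF _; elim: (s) => [|d t IHt]; first by rewrite !big_nil.
by rewrite !big_cons addvS // capvS.
Qed.

(** One list serves every stable subspace, because the generalized eigenspaces outside it vanish by
    independence. *)
Lemma spectrum_exists f : exists2 s : seq K, uniq s &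
  (forall c, c \notin s -> geig f c = 0%VS) /\
  forall U, stablev f U -> (U <= \sum_(c <- s) (U :&: geig f c))%VS.
Proof.
have [|s0 Vs0] := @stablev_geig_sum f {:V}; first by move=> x _; apply: memvf.
pose s := undup s0.
have Vs : ({:V} <= \sum_(c <- s) geig f c)%VS.
  apply: subv_trans Vs0 (sum_subvP _) => c cs; rewrite capfv.
  by apply: (subv_sum_mem (geig f)); rewrite mem_undup.
have out c : c \notin s -> geig f c = 0%VS.
  move=> cs; apply/eqP; rewrite -subv0; apply/subvP => x xc; rewrite memv0.
  apply/eqP; apply: (@geig_sum_disjoint _ _ f s c) => //; first exact: undup_uniq.
  by apply: (subvP Vs); apply: memvf.
exists s; first exact: undup_uniq.
split=> // U /stablev_geig_sum[t Ut]; apply: subv_trans Ut (sum_subvP _) => c ct.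
have [cs|/out ->] := boolP (c \in s); last by rewrite capv0 sub0v.
exact: (subv_sum_mem (fun c => (U :&: geig f c)%VS)).
Qed.

End Spectrum.

(** * Traces on stable subspaces *)

Section Trace.
Context (K : fieldType) (V : vectType K).
Implicit Types (f h p : 'End(V)) (U W : {vspace V}) (c : K).

Local Notation e := (vbasis {:V}).

Definition ltr f : K := \tr (passmx.mxof e e f).

Lemma ltr_is_scalar : scalar ltr.
Proof. by move=> a f h; rewrite /ltr passmx.mxof_linear mxtraceD mxtraceZ. Qed.

HB.instance Definition _ := GRing.isLinear.Build K 'End(V) K _ ltr ltr_is_scalar.

Lemma ltrC f h : ltr (f \o h)%VF = ltr (h \o f)%VF.
Proof. by rewrite /ltr !(passmx.mxof_comp _ _ (vbasisP _)) mxtrace_mulC. Qed.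

Lemma ltrE f : ltr f = \sum_i coord e i (f e`_i).
Proof.
by apply: eq_bigr => i _; rewrite !mxE /= -?rowE ?passmx.vecof_delta.
Qed.

Lemma ltr_rank1 (phi : {linear V -> K^o}) f u :
  (forall x, f x = phi x *: u) -> ltr f = phi u.
Proof.
move=> fE; rewrite ltrE [in RHS](coord_vbasis (memvf u)) linear_sum /=.
apply: eq_bigr => i _; rewrite fE !linearZ /=.
by rewrite /GRing.scale /= mulrC.
Qed.

(** The trace of the restriction of [f] when [U] is stable, without forming the restricted
    endomorphism; by [trv_proj] any projection onto [U] gives the same value. *)
Definition trv U f : K := ltr (f \o projv U)%VF.

Lemma trv_linear U : scalar (trv U).
Proof. by move=> a f h; rewrite /trv comp_lfunDl -comp_lfunZl linearP. Qed.

HB.instance Definition _ U := GRing.isLinear.Build K 'End(V) K _ (trv U) (trv_linear U).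

Definition proj_onto U p := (forall x, p x \in U) /\ {in U, p =1 id}.

Lemma projv_onto U : proj_onto U (projv U).
Proof. by split=> [x|x xU]; rewrite ?memv_proj ?projv_id. Qed.

(** With q = [projv U], f q = p f q because its image lies in [U], and cyclicity turns tr (p f q)
    into tr (f q p) = tr (f p). *)
Lemma trv_proj U f p : stablev f U -> proj_onto U p -> trv U f = ltr (f \o p)%VF.
Proof.
move=> fU [pU pid]; have [qU qid] := projv_onto U.
rewrite /trv; set q := projv U in qU qid *.
have -> : (f \o q = p \o (f \o q))%VF.
  by apply/lfunP => x; rewrite !comp_lfunE pid ?fU.
rewrite [LHS]ltrC -comp_lfunA; congr (ltr (f \o _)%VF).
by apply/lfunP => x; rewrite !comp_lfunE qid.
Qed.

Lemma trv_full f : trv {:V} f = ltr f.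
Proof.
rewrite (@trv_proj _ _ \1%VF) ?comp_lfun1r //; first by move=> x _; apply: memvf.
by split=> x; rewrite ?memvf ?id_lfunE.
Qed.

Lemma trv_addv U W f : stablev f U -> stablev f W -> (U :&: W = 0)%VS ->
  trv (U + W) f = trv U f + trv W f.
Proof.
move=> fU fW dis; have dis' : (W :&: U = 0)%VS by rewrite capvC.
pose q := projv (U + W); have [qU qid] := projv_onto (U + W).
have st : stablev f (U + W).
  by move=> _ /memv_addP[u uU [w wW ->]]; rewrite linearD memv_add ?fU ?fW.
rewrite (@trv_proj U f (daddv_pi U W \o q)%VF) //; last first.
  split=> [x|x xU]; rewrite comp_lfunE ?memv_pi // qid ?daddv_pi_id //.
  exact: (subvP (addvSl _ _)).
rewrite (@trv_proj W f (daddv_pi W U \o q)%VF) //; last first.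
  split=> [x|x xU]; rewrite comp_lfunE ?memv_pi // qid ?daddv_pi_id //.
  exact: (subvP (addvSr _ _)).
rewrite -linearD /=; congr ltr; apply/lfunP => x.
rewrite add_lfunE !comp_lfunE -linearD; congr (f _).
by rewrite -/q daddv_pi_add // qU.
Qed.

Lemma trv0 f : trv 0 f = 0.
Proof.
rewrite (@trv_proj _ _ 0) ?comp_lfun0r ?linear0 //.
  by move=> x; rewrite !memv0 => /eqP->; rewrite linear0.
by split=> [x|x]; rewrite ?mem0v //= zero_lfunE ?mem0v // memv0 => /eqP.
Qed.

Lemma trvC U f h : stablev f U -> stablev h U -> trv U (f \o h)%VF = trv U (h \o f)%VF.
Proof.
move=> fU hU; have [qU qid] := projv_onto U; rewrite /trv; set q := projv U in qU qid *.
have E a b : stablev a U -> ((b \o a) \o q = (b \o q) \o (a \o q))%VF.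
  by move=> aU; apply/lfunP => x; rewrite !comp_lfunE [q (a _)]qid ?aU.
by rewrite !E // ltrC.
Qed.

Lemma trv_comm U f h : stablev f U -> stablev h U ->
  trv U ((f \o h) - (h \o f))%VF = 0.
Proof. by move=> fU hU; rewrite linearB /= trvC // subrr. Qed.

(* Iterating this yields the vanishing of the trace of a nilpotent operator. *)
Lemma trv_img U f : stablev f U -> trv U f = trv (f @: U) f.
Proof.
move=> fU; have [qU qid] := projv_onto U; have [rU rid] := projv_onto (f @: U).
rewrite /trv; set q := projv U in qU qid *; set r := projv _ in rU rid *.
have -> : (f \o q = r \o (f \o q))%VF.
  by apply/lfunP => x; rewrite !comp_lfunE rid ?memv_img.
rewrite [LHS]ltrC -comp_lfunA; congr (ltr (f \o _)%VF).
apply/lfunP => x; rewrite !comp_lfunE qid //.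
by case/memv_imgP: (rU x) => y yU ->; apply: fU.
Qed.

Lemma trv_nilp U f : stablev f U ->
  (forall x, x \in U -> exists n, iter n f x = 0) -> trv U f = 0.
Proof.
move=> fU /nilp_uniform[n]; elim: n => [|n IHn] in U fU * => U0.
  have -> : U = 0%VS by apply/eqP; rewrite -subv0; apply/subvP => x /U0 /= ->; apply: mem0v.
  exact: trv0.
rewrite trv_img // IHn // => _ /memv_imgP[x xU ->].
  by apply: memv_img; apply: fU.
by rewrite -iterSr U0.
Qed.

Lemma trv_line v : v != 0 -> trv <[v]> \1%VF = 1.
Proof.
move=> v0; rewrite /trv comp_lfun1l.
have fr : free [tuple v] by rewrite seq1_free.
pose phi := coord [tuple v] ord0 \o projv <[v]>.
rewrite (@ltr_rank1 phi _ v) /phi /= => [|x].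
  by rewrite projv_id ?memv_line // -[v in X in coord _ _ X]/([tuple v]`_(@ord0 0)) coord_free.
have := memv_proj <[v]> x; rewrite -span_seq1 => /(coord_span (X := [tuple v])).
by rewrite big_ord1.
Qed.

Lemma trv_id U : trv U \1%VF = (\dim U)%:R.
Proof.
have id_stable W : stablev \1%VF W by move=> x; rewrite id_lfunE.
have bU := vbasisP U.
have : trv <<vbasis U>> \1%VF = (size (vbasis U))%:R; last first.
  by rewrite size_tuple (span_basis bU).
elim: (vbasis U : seq V) (basis_free bU) => [_|v s IHs].
  by rewrite span_nil trv0.
rewrite free_cons => /andP[vs fs]; rewrite span_cons trv_addv //.
  rewrite trv_line ?IHs //= ?mulrS //.
  by apply: contraNneq vs => ->; rewrite mem0v.
apply/vspaceP => x; rewrite memv_cap memv0; apply/andP/eqP => [[]|->]; last by rewrite !mem0v.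
case/vlineP=> k ->; have [->|k0] := eqVneq k 0; first by rewrite scale0r.
by move/(memvZ k^-1); rewrite scalerA mulVf // scale1r (negPf vs).
Qed.

End Trace.

(** * Engel's theorem *)

Section LieBasics.
Context (K : fieldType) (g : vectLieType K).
Implicit Types (x y z h : g) (A B U V W M : {vspace g}).

(* [lie] retyped so that its values live in [g] as a [vectLieType]. *)
Definition br x y : g := lie x y.

Lemma br_linear x : linear (br x). Proof. exact: lie_linearr. Qed.

HB.instance Definition _ x := GRing.isLinear.Build K g g _ (br x) (br_linear x).

Definition ad x : 'End(g) := linfun (br x).

Lemma adE x y : ad x y = br x y. Proof. exact: lfunE. Qed.

Lemma brxx x : br x x = 0. Proof. exact: liexx. Qed.

Lemma br_anti x y : br x y = - br y x.
Proof.
have brDl a b c : br (a + b) c = br a c + br b c.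
  by have := lie_linearl c 1 a b; rewrite /= !scale1r.
apply/eqP; rewrite -addr_eq0; apply/eqP.
have := brxx (x + y); rewrite linearD /=.
by rewrite !brDl !brxx add0r addr0 addrC.
Qed.

Lemma br0r x : br x 0 = 0. Proof. exact: linear0. Qed.
Lemma br0l x : br 0 x = 0. Proof. by rewrite br_anti br0r oppr0. Qed.
Lemma brDr x y z : br x (y + z) = br x y + br x z. Proof. exact: linearD. Qed.
Lemma brDl x y z : br (x + y) z = br x z + br y z.
Proof. by rewrite br_anti brDr opprD -!(br_anti _ z). Qed.
Lemma brZr a x y : br x (a *: y) = a *: br x y. Proof. exact: linearZ. Qed.
Lemma brZl a x y : br (a *: x) y = a *: br x y.
Proof. by rewrite br_anti brZr -scalerN -br_anti. Qed.
Lemma brBl x y z : br (x - y) z = br x z - br y z.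
Proof. by rewrite -[- y]scaleN1r brDl brZl scaleN1r. Qed.
Lemma brBr x y z : br x (y - z) = br x y - br x z. Proof. exact: linearB. Qed.
Lemma brNr x y : br x (- y) = - br x y. Proof. exact: linearN. Qed.

Lemma ad_is_linear : linear ad.
Proof.
by move=> a x y; apply/lfunP => z; rewrite add_lfunE scale_lfunE !adE brDl brZl.
Qed.

HB.instance Definition _ := GRing.isLinear.Build K g 'End(g) _ ad ad_is_linear.

Lemma br_der x y z : br x (br y z) = br (br x y) z + br y (br x z).
Proof.
have /eqP : br x (br y z) + br y (br z x) + br z (br x y) = 0 by exact: lie_jacobi.
 rewrite -addrA addr_eq0 => /eqP ->.
by rewrite opprD addrC -br_anti [br z x]br_anti brNr opprK.
Qed.

Lemma ad_lie x y : ad (br x y) = ((ad x \o ad y) - (ad y \o ad x))%VF.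
Proof.
apply/lfunP => z; rewrite add_lfunE opp_lfunE !comp_lfunE !adE.
by rewrite br_der addrK.
Qed.

Lemma geig_lie h a b x y :
  x \in geig (ad h) a -> y \in geig (ad h) b -> br x y \in geig (ad h) (a + b).
Proof.
move=> /mem_geig[n xn] /mem_geig[m ym].
have [N leN] := ubnP (n + m)%N; elim: N => // N IHN in n m x y leN xn ym *.
case: n => [|n] in leN xn; first by rewrite [x]xn br0l mem0v.
case: m => [|m] in leN ym; first by rewrite [y]ym br0r mem0v.
set D := (ad h - (a + b) *: \1%VF)%VF.
have /mem_geig[k Dk] : D (br x y) \in geig (ad h) (a + b).
  have -> : D (br x y) = br ((ad h - a *: \1%VF)%VF x) y
                        + br x ((ad h - b *: \1%VF)%VF y).
    rewrite !shiftE !adE brBl brZl brBr brZr br_der.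
    by rewrite scalerDl opprD addrACA.
  rewrite memvD //.
    by apply: (IHN n m.+1); [lia|rewrite -iterSr|].
  by apply: (IHN n.+1 m); [lia| |rewrite -iterSr].
by apply/mem_geig; exists k.+1; rewrite iterSr.
Qed.

Lemma subalgebraP A :
  subalgebra A <-> (forall x y, x \in A -> y \in A -> br x y \in A).
Proof. by []. Qed.

Lemma mem_lie_span A B x y : x \in A -> y \in B -> br x y \in lie_span A B.
Proof. by move=> xA yB; apply: mem_lspan; exists x, y. Qed.

Lemma lie_span_sub A B W :
  (forall x y, x \in A -> y \in B -> br x y \in W) -> (lie_span A B <= W)%VS.
Proof. by move=> ABW; apply/lspan_subvP => _ [x [y [xA yB ->]]]; apply: ABW. Qed.

Lemma lspan_liel (S : set g) y W :
  (forall x, S x -> br x y \in W) -> forall x, x \in lspan S -> br x y \in W.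
Proof.
move=> SW x xS; suff /subvP/(_ x xS) : (lspan S <= ad y @^-1: W)%VS.
  by rewrite -memv_preim adE br_anti memvN.
by apply/lspan_subvP => z /SW; rewrite -memv_preim adE br_anti memvN.
Qed.

Lemma lspan_lier (S : set g) x W :
  (forall y, S y -> br x y \in W) -> forall y, y \in lspan S -> br x y \in W.
Proof.
move=> SW y; rewrite br_anti memvN; apply: lspan_liel => z /SW.
by rewrite br_anti memvN.
Qed.

(* Every chain of [M]-submodules [U < W <= V] has [U + [M, W] < W]; this is    *)
(* nilpotency of the action of [M], in the form that passes to [M + <[s]>].    *)
Definition nil_action M V := forall U W,
  (U <= W)%VS -> (W <= V)%VS -> ~~ (W <= U)%VS ->
  (forall m, m \in M -> stablev (ad m) U /\ stablev (ad m) W) ->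
  ~~ (W <= U + lie_span M W)%VS.

(** With W1 = U + [M, W], which is stable under [s], a failure would give W <= W1 + [s, W].
    Iterating gives W <= W1 + (ad s)^n W = W1, against the hypothesis on M. *)
Lemma nil_action_extend M V s :
  nil_action M V -> (forall m, m \in M -> br m s \in M) ->
  (forall v, v \in V -> exists n, iter n (ad s) v = 0) ->
  nil_action (M + <[s]>)%VS V.
Proof.
move=> nM Ms /nilp_uniform[n sn] U W UW WV nWU st.
have stM m : m \in M -> stablev (ad m) U /\ stablev (ad m) W.
  by move=> mM; apply: st; apply: (subvP (addvSl _ _)).
have [sU sW] : stablev (ad s) U /\ stablev (ad s) W.
  by apply: st; apply: (subvP (addvSr _ _)); apply: memv_line.
pose W1 := (U + lie_span M W)%VS.
have nWW1 : ~~ (W <= W1)%VS by apply: nM.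
have sW1 : stablev (ad s) W1.
  move=> _ /memv_addP[u uU [v vW ->]]; rewrite linearD memv_add ?sU //= adE.
  apply: lspan_lier vW => _ [m [w [mM wW ->]]].
  rewrite br_der memvD //; apply: mem_lie_span => //.
    by rewrite br_anti memvN Ms.
  by rewrite -adE sW.
apply: contra nWW1 => Wle.
have Wle1 : (W <= W1 + ad s @: W)%VS.
  apply: subv_trans Wle _; rewrite subv_add; apply/andP; split.
    by apply: subv_trans (addvSl _ _); apply: addvSl.
  apply: lie_span_sub => _ w /memv_addP[m mM [_ /vlineP[k ->] ->]] wW.
  rewrite brDl brZl memv_add ?memvZ //; last by rewrite -adE memv_img.
  by apply: (subvP (addvSr _ _)); apply: mem_lie_span.
have Wk k : (W <= W1 + lpow (ad s) k @: W)%VS.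
  elim: k => [|k IHk]; first by rewrite /lpow /= lim1g addvSr.
  apply: subv_trans Wle1 _; rewrite subv_add addvSl /=.
  apply: subv_trans (limgS _ IHk) _; rewrite limgD addvS //.
    by apply/subvP => _ /memv_imgP[x xW ->]; apply: sW1.
  by rewrite -limg_comp.
apply: subv_trans (Wk n) _; rewrite subv_add subvv /=.
apply/subvP => _ /memv_imgP[w wW ->].
by rewrite lpowE sn ?mem0v //; apply: (subvP WV).
Qed.

(* Jacobson's form of Engel's theorem. *)
Lemma engel (S : set g) V :
  (forall x y, S x -> S y -> S (br x y)) -> (forall x, S x -> x \in V) ->
  (forall x, S x -> forall v, v \in V -> exists n, iter n (ad x) v = 0) ->
  nil_action (lspan S) V.
Proof.
move=> Slie SV nilS.
pose spanned W := (W <= lspan [set x | S x /\ x \in W])%VS.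
pose P M := [/\ (M <= lspan S)%VS, spanned M, subalgebra M & nil_action M V].
(* Subalgebras spanned by elements of [S] and acting nilpotently are enlarged until they fill the
   span of [S]. *)
suff key n : (n <= \dim (lspan S))%N -> exists2 M, P M & (n <= \dim M)%N.
  have [M [MS _ _ nM] dM] := key _ (leqnn _).
  by have /eqP <- : M == lspan S by rewrite eqEdim MS.
elim: n => [_|n IHn nS].
  exists 0%VS => //; split; rewrite /spanned ?sub0v //.
    by apply/subalgebraP => x y; rewrite !memv0 => /eqP-> _; rewrite br0l.
  move=> U W UW WV nWU _; suff -> : lie_span 0 W = 0%VS by rewrite addv0.
  apply/eqP; rewrite -subv0; apply: lie_span_sub => x y.
  by rewrite !memv0 => /eqP-> _; rewrite br0l.
have [M [MS sM aM nM] dM] := IHn (ltnW nS).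
have [ge|lt] := leqP n.+1 (\dim M); first by exists M.
have nSM : ~~ (lspan S <= M)%VS by apply: contraTN lt => /dimvS; lia.
have SlieS x y : x \in lspan S -> y \in lspan S -> br x y \in lspan S.
  move=> xS; apply: lspan_lier => {}y Sy; move: x xS; apply: lspan_liel => x Sx.
  exact/mem_lspan/Slie.
have SleV : (lspan S <= V)%VS by apply/lspan_subvP.
(* A minimal M-module W strictly above M satisfies [M, W] <= M, since M acts nilpotently. Any
   element of [S] in W outside M then normalizes M and can be adjoined. *)
pose Q W := [/\ (M <= W)%VS, (W <= lspan S)%VS,
  (forall m, m \in M -> stablev (ad m) W), spanned W & ~~ (W <= M)%VS].
have exQ : exists k, `[< exists2 W, Q W & \dim W = k >].
  exists (\dim (lspan S)); apply/asboolP; exists (lspan S) => //; split=> //.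
    by move=> m mM x xS; rewrite adE SlieS // (subvP MS).
  by apply/lspan_subvP => x Sx; apply: mem_lspan; split=> //; apply: mem_lspan.
case: (ex_minnP exQ) => k /asboolP[W [MW WS stW sW nWM] dW] minW.
have WMW : (lie_span M W <= W)%VS.
  by apply: lie_span_sub => x y xM yW; rewrite -adE stW.
pose U := (M + lie_span M W)%VS.
have UW : (U <= W)%VS by rewrite subv_add MW WMW.
have stM m : m \in M -> stablev (ad m) M by move=> mM x xM; rewrite adE aM.
have nWU : ~~ (W <= U)%VS.
  by apply: nM => // [|m mM]; [apply: subv_trans WS _ | split; [exact: stM|exact: stW]].
have UM : (U <= M)%VS.
  apply: contraNT nWU => nUM.
  have QU : Q U.
    split=> //; first exact: addvSl.
    - exact: subv_trans UW WS.
    - move=> m mM _ /memv_addP[u uM [v vW ->]]; rewrite linearD memv_add ?stM //= adE.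
      by apply: mem_lie_span => //; apply: (subvP WMW).
    rewrite /spanned {1}/U subv_add; apply/andP; split.
      apply: subv_trans sM _; apply/lspan_subvP => x [Sx xM].
      by apply: mem_lspan; split=> //; apply: (subvP (addvSl _ _)).
    apply: lie_span_sub => x y /(subvP sM) xM /(subvP sW) yW.
    move: y yW; apply: lspan_lier => y [Sy yW]; move: x xM; apply: lspan_liel => x [Sx xM].
    apply: mem_lspan; split; first exact: Slie.
    by apply: (subvP (addvSr _ _)); apply: mem_lie_span.
  have /minW : `[< exists2 W, Q W & \dim W = \dim U >] by apply/asboolP; exists U.
  by rewrite -dW => dWU; have /eqP <- : U == W by rewrite eqEdim UW.
have [s [Ss sW' nsM]] : exists s, [/\ S s, s \in W & s \notin M].
  apply: contrapT => H; case/negP: nWM; apply: subv_trans sW _.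
  apply/lspan_subvP => s [Ss sW']; apply: contraT => nsM.
  by case: H; exists s.
have Ms m : m \in M -> br m s \in M.
  move=> mM; apply: (subvP UM); apply: (subvP (addvSr _ _)); exact: mem_lie_span.
exists (M + <[s]>)%VS; last first.
  rewrite (leq_trans (n := (\dim M).+1)) //.
  have /dimv_leqif_sup/leqifP : (M <= M + <[s]>)%VS by apply: addvSl.
  case: ifP => // /subvP/(_ s); rewrite (negPf nsM) => /(_ _)/notF[].
  by apply: (subvP (addvSr _ _)); apply: memv_line.
split.
- by rewrite subv_add MS; apply/subvP => _ /vlineP[c ->]; rewrite memvZ ?mem_lspan.
- rewrite /spanned {1}subv_add; apply/andP; split.
    apply: subv_trans sM _; apply/lspan_subvP => x [Sx xM].
    by apply: mem_lspan; split=> //; apply: (subvP (addvSl _ _)).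
  apply/subvP => _ /vlineP[c ->]; rewrite memvZ // mem_lspan //; split=> //.
  by apply: (subvP (addvSr _ _)); apply: memv_line.
- apply/subalgebraP => _ _ /memv_addP[m mM [_ /vlineP[c ->] ->]] /memv_addP[m' m'M [_ /vlineP[d ->] ->]].
  rewrite brDl !brDr !brZl !brZr brxx !scaler0 addr0.
  have sM' : br s m' \in M by rewrite br_anti memvN Ms.
  by apply: (subvP (addvSl _ _)); rewrite !memvD ?memvZ ?sM' ?Ms ?aM.
- by apply: nil_action_extend => //; apply: nilS.
Qed.

End LieBasics.

(** * Weights of a Cartan subalgebra *)

Section Weights.
Context (K : numClosedFieldType) (g : vectLieType K).
Implicit Types (x y z h : g) (A B U V W M H : {vspace g}).

Lemma mem_geig0 (f : 'End(g)) x : x \in geig f 0 <-> exists n, iter n f x = 0.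
Proof. by rewrite mem_geig scale0r subr0. Qed.

Lemma cartan_geig0 H h : cartan_subalgebra H -> h \in H -> (H <= geig (ad h) 0)%VS.
Proof.
case=> _ [n Hn] _ hH; apply/subvP => x xH; apply/mem_geig0; exists n.
suff : iter n (ad h) x \in lower_central n H by rewrite Hn memv0 => /eqP.
elim: n {Hn} => //= n IHn; rewrite adE; exact: mem_lie_span.
Qed.

(* The eigenvalue of [ad h] on [W] when it is unique; as a normalized trace it *)
(* is linear in [h].  It is 0 when [W] is.                                     *)
Definition wt W h : K := trv W (ad h) / (\dim W)%:R.

Lemma wt_is_scalar W : scalar (wt W).
Proof. by move=> a x y; rewrite /wt !linearP mulrDl mulrA. Qed.

HB.instance Definition _ W := GRing.isLinear.Build K g K _ (wt W) (wt_is_scalar W).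

Lemma dim_neq0 W : W != 0%VS -> (\dim W)%:R != 0 :> K.
Proof. by move=> W0; rewrite pnatr_eq0 dimv_eq0. Qed.

Lemma trv_wt W h : trv W (ad h) = (\dim W)%:R * wt W h.
Proof.
have [->|W0] := eqVneq W 0%VS; first by rewrite trv0 dimv0 mul0r.
by rewrite /wt mulrC divfK // dim_neq0.
Qed.

Lemma wt_geig W h c : W != 0%VS -> stablev (ad h) W -> (W <= geig (ad h) c)%VS ->
  c = wt W h.
Proof.
move=> W0 hW Wc; have : trv W (ad h - c *: \1%VF)%VF = 0.
  apply: trv_nilp; first exact: stablev_shift.
  by move=> x xW; apply/mem_geig/(subvP Wc).
rewrite linearB linearZ /= trv_id => /eqP; rewrite subr_eq0 => /eqP E.
by rewrite /wt E mulfK // dim_neq0.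
Qed.

Definition stable_under H W := forall h, h \in H -> stablev (ad h) W.

Lemma stable_geig H h c : (forall x, x \in H -> x \in geig (ad h) 0) ->
  stable_under H (geig (ad h) c).
Proof.
by move=> Hh x /Hh x0 y yc; rewrite adE -[c]add0r; apply: geig_lie.
Qed.

Lemma stable_cap H U W : stable_under H U -> stable_under H W ->
  stable_under H (U :&: W)%VS.
Proof.
by move=> hU hW h hH x; rewrite !memv_cap => /andP[xU xW]; rewrite hU ?hW.
Qed.

Definition piece H W := [/\ W != 0%VS, stable_under H W &
  forall h, h \in H -> exists c, (W <= geig (ad h) c)%VS].

(** If some [ad h] has no single eigenvalue on [V], its generalized eigenspaces cut [V] into smaller
    subspaces; these are stable under [H] by [geig_lie]. *)
Lemma pieces_exist H V :
  (forall h x, h \in H -> x \in H -> x \in geig (ad h) 0) -> stable_under H V ->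
  exists2 Vs : seq {vspace g}, (V <= \sum_(W <- Vs) W)%VS &
    forall W, W \in Vs -> piece H W.
Proof.
move=> H0; have [n leVn] := ubnP (\dim V); elim: n => // n IHn in V leVn *.
move=> HV; have [->|V0] := eqVneq V 0%VS.
  by exists [::]; rewrite ?sub0v.
have [sV|] := pselect (forall h, h \in H -> exists c, (V <= geig (ad h) c)%VS).
  exists [:: V]; first by rewrite big_seq1.
  by move=> W; rewrite inE => /eqP->.
move=> /existsNP[h /not_implyP[hH /forallNP nV]].
have [s us [_ /(_ V (HV h hH)) Vs]] := spectrum_exists (ad h).
suff : exists2 Vs : seq {vspace g},
    (\sum_(c <- s) (V :&: geig (ad h) c) <= \sum_(W <- Vs) W)%VS &
    forall W, W \in Vs -> piece H W.
  by case=> Ws sWs Wsp; exists Ws => //; apply: subv_trans sWs.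
elim: (s) => [|c t [Ws tWs Wsp]]; first by exists [::]; rewrite ?big_nil.
have [||Ws' Vc Ws'p] := IHn (V :&: geig (ad h) c)%VS.
- have := dimv_leqif_sup (capvSl V (geig (ad h) c)) => /leqifP.
  by rewrite subv_cap subvv (negPf (introN idP (nV c))) /=; lia.
- by apply: stable_cap => //; apply: stable_geig => x xH; apply: H0.
exists (Ws' ++ Ws); first by rewrite big_cons big_cat addvS.
by move=> W; rewrite mem_cat => /orP[/Ws'p|/Wsp].
Qed.

(** In characteristic 0 no finite union of proper subspaces covers [H]. When the old choice h falls
    into the new subspace U and x in H avoids it, every k h + x avoids U, and each other subspace
    that does not contain [H] meets this sequence at most once. *)
Lemma avoid_subspaces H (Us : seq {vspace g}) :
  exists2 h, h \in H & forall U, U \in Us -> h \in U -> (H <= U)%VS.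
Proof.
elim: Us => [|U Us [h hH hUs]]; first by exists 0; rewrite ?mem0v.
have [HU|/subvPn[x xH xU]] := boolP (H <= U)%VS.
  by exists h => // W; rewrite inE => /orP[/eqP->//|/hUs].
have [hU|hU] := boolP (h \in U); last first.
  exists h => // W; rewrite inE => /orP[/eqP->|/hUs//].
  by rewrite (negPf hU).
suff [N hN] : exists N, forall k, (N <= k)%N ->
    forall W, W \in Us -> k%:R *: h + x \in W -> (H <= W)%VS.
  exists (N%:R *: h + x); first by rewrite memvD ?memvZ.
  move=> W; rewrite inE => /orP[/eqP->|/(hN _ (leqnn N))//].
  by rewrite rpredDl ?memvZ // (negPf xU).
elim: Us hUs => [|W Us IHUs] hUs; first by exists 0%N.
have [|N hN] := IHUs; first by move=> W' W'U; apply: hUs; rewrite inE W'U orbT.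
have [HW|nHW] := boolP (H <= W)%VS.
  by exists N => k Nk W'; rewrite inE => /orP[/eqP->//|/(hN _ Nk)].
have [[m mW]|nm] := pselect (exists m : nat, m%:R *: h + x \in W); last first.
  exists N => k Nk W'; rewrite inE => /orP[/eqP->|/(hN _ Nk)//] kW.
  by case: nm; exists k.
exists (maxn N m.+1) => k; rewrite geq_max => /andP[Nk mk] W'.
rewrite inE => /orP[/eqP->|/(hN _ Nk)//] kW.
apply: (hUs W (mem_head _ _)).
have := memvB kW mW; rewrite opprD addrACA subrr addr0 -scalerBl -natrB; last exact: ltnW.
move/(memvZ ((k - m)%:R^-1)); rewrite scalerA mulVf ?scale1r //.
by rewrite pnatr_eq0; lia.
Qed.

End Weights.

Section CartanDecomposition.
Context (K : numClosedFieldType) (g : vectLieType K).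
Implicit Types (x y z h : g) (A B U V W M H : {vspace g}).

Lemma wt0 h : wt (0 : {vspace g}) h = 0.
Proof. by rewrite /wt trv0 mul0r. Qed.

(* [h0] is chosen off the kernels of all nonzero w1 + w2 - w3, with w1, w2, w3 *)
(* weights or 0: it separates the weights and detects their additive relations. *)
Lemma cartan_weights H : cartan_subalgebra H -> exists2 h0, h0 \in H &
  [/\ (forall c h, h \in H ->
         (geig (ad h0) c <= geig (ad h) (wt (geig (ad h0) c) h))%VS),
      (forall h, h \in H -> (geig (ad h0) 0 <= geig (ad h) 0)%VS) &
      forall c d, geig (ad h0) c != 0%VS -> geig (ad h0) d != 0%VS ->
        geig (ad h0) (c + d) != 0%VS -> forall h, h \in H ->
        wt (geig (ad h0) (c + d)) h = wt (geig (ad h0) c) h + wt (geig (ad h0) d) h].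
Proof.
move=> cH.
have H0 h x : h \in H -> x \in H -> x \in geig (ad h) 0.
  by move=> hH; apply/subvP/cartan_geig0.
have [Vs gVs Vsp] : exists2 Vs : seq {vspace g},
    ({:g} <= \sum_(W <- Vs) W)%VS & forall W, W \in Vs -> piece H W.
  by apply: pieces_exist => // h _ x _; apply: memvf.
(* The zero space has weight 0, so equality of two weights and vanishing of one weight are instances
   of the three-term relations. *)
pose Ws := 0%VS :: Vs.
pose ker3 W1 (W23 : {vspace g} * {vspace g}) :=
  lspan [set h | wt W1 h + wt W23.1 h - wt W23.2 h = 0].
have mem_ker3 W1 W2 W3 h : h \in ker3 W1 (W2, W3) <-> wt W1 h + wt W2 h - wt W3 h = 0.
  apply: (mem_lspan_closed (S := [set h | wt W1 h + wt W2 h - wt W3 h = 0])) => /=.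
    by rewrite !linear0 addr0 subr0.
  move=> a u w u0 w0; rewrite !linearP /=.
  transitivity (a * (wt W1 u + wt W2 u - wt W3 u) + (wt W1 w + wt W2 w - wt W3 w)).
    by ring.
  by rewrite u0 w0 mulr0 addr0.
have [h0 h0H gen] := avoid_subspaces H
  [seq ker3 W p | W <- Ws, p <- [seq (X, Y) | X <- Ws, Y <- Ws]].
have gen3 W1 W2 W3 : W1 \in Ws -> W2 \in Ws -> W3 \in Ws ->
    wt W1 h0 + wt W2 h0 = wt W3 h0 -> forall h, h \in H -> wt W1 h + wt W2 h = wt W3 h.
  move=> W1s W2s W3s E h hH; apply/eqP; rewrite -subr_eq0; apply/eqP.
  apply/mem_ker3; apply: (subvP (gen (ker3 W1 (W2, W3)) _ _)) hH.
    by apply: allpairs_f => //; apply: allpairs_f.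
  by apply/mem_ker3; rewrite E subrr.
have W0s : 0%VS \in Ws by rewrite mem_head.
have VsWs W : W \in Vs -> W \in Ws by rewrite inE => ->; rewrite orbT.
have piece_geig W h : W \in Vs -> h \in H -> (W <= geig (ad h) (wt W h))%VS.
  move=> /Vsp[W0 HW sW] hH; have [c Wc] := sW h hH.
  by rewrite -(wt_geig W0 (HW h hH) Wc).
exists h0 => //; set E := geig (ad h0).
(* Decompose x in E c along the pieces: those of [h0]-weight other than c contribute a vector of E c
   lying in the sum of the other eigenspaces, hence 0. *)
have E_sub c : (E c <= \sum_(W <- [seq W <- Vs | wt W h0 == c]) W)%VS.
  have [s us [out _]] := spectrum_exists (ad h0).
  pose s' := [seq d <- s | d != c].
  have gsum : ({:g} <= \sum_(W <- [seq W <- Vs | wt W h0 == c]) W + \sum_(d <- s') E d)%VS.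
    apply: subv_trans gVs (sum_subvP _) => W WVs.
    have [Wc|Wc] := boolP (wt W h0 == c).
      apply: subv_trans (addvSl _ _).
      by apply: (subv_sum_mem (fun W : {vspace g} => W)); rewrite mem_filter Wc.
    apply: subv_trans (addvSr _ _); apply: subv_trans (piece_geig W h0 WVs h0H) _.
    apply: (subv_sum_mem E); rewrite mem_filter Wc /=.
    apply: contraT => /out E0; have [W0' _ _] := Vsp W WVs.
    have := piece_geig W h0 WVs h0H.
    by rewrite E0 subv0 (negPf W0').
  apply/subvP => x xc.
  have /(subvP gsum)/memv_addP[u uW [v vs xE]] := memvf x.
  have uc : u \in E c.
    apply: (subvP _ _ uW); apply: sum_subvP => W; rewrite mem_filter.
    by case/andP=> /eqP <- WVs; apply: piece_geig.
  have v0 : v = 0.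
    apply: (@geig_sum_disjoint _ _ (ad h0) s' c) vs.
    - exact: filter_uniq.
    - by rewrite mem_filter eqxx.
    - by have -> : v = x - u; [rewrite xE addrC addKr | rewrite memvB].
  by rewrite xE v0 addr0.
have Estable c : stable_under H (E c) by apply: stable_geig => x xH; apply: H0.
have Ewt c : E c != 0%VS -> exists W, [/\ W \in Vs, wt W h0 = c &
    forall h, h \in H -> (E c <= geig (ad h) (wt W h))%VS].
  move=> Ec0; have [[W WVs Wc]|nW] := pselect (exists2 W, W \in Vs & wt W h0 = c).
    exists W; split=> // h hH; apply: subv_trans (E_sub c) (sum_subvP _) => W'.
    rewrite mem_filter => /andP[/eqP W'c W'Vs].
    suff -> : wt W h = wt W' h by apply: piece_geig.
    by rewrite -(gen3 W' 0%VS W (VsWs _ W'Vs) W0s (VsWs _ WVs)) ?wt0 ?addr0 // Wc W'c.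
  case/negP: Ec0; rewrite -subv0; apply: subv_trans (E_sub c) (sum_subvP _) => W.
  by rewrite mem_filter => /andP[/eqP Wc WVs]; case: nW; exists W.
split.
- move=> c h hH; rewrite -/E; have [->|Ec0] := eqVneq (E c) 0%VS; first exact: sub0v.
  have [W [WVs Wc Wle]] := Ewt c Ec0.
  by rewrite -(wt_geig Ec0 (Estable c h hH) (Wle h hH)) Wle.
- move=> h hH; have [E0|E0] := eqVneq (E 0) 0%VS; first by rewrite -/E E0 sub0v.
  have [W [WVs Wc Wle]] := Ewt 0 E0.
  suff h0E : wt W h = 0 by rewrite -[X in geig (ad h) X]h0E; apply: Wle.
  by rewrite -(gen3 0%VS 0%VS W W0s W0s (VsWs _ WVs)) ?wt0 ?addr0 // Wc.
- move=> c d Ec0 Ed0 Ecd0 h hH.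
  have [W [WVs Wc Wle]] := Ewt c Ec0.
  have [X [XVs Xd Xle]] := Ewt d Ed0.
  have [Y [YVs Ycd Yle]] := Ewt _ Ecd0.
  rewrite -(wt_geig Ec0 (Estable _ h hH) (Wle h hH)).
  rewrite -(wt_geig Ed0 (Estable _ h hH) (Xle h hH)).
  rewrite -(wt_geig Ecd0 (Estable _ h hH) (Yle h hH)).
  by rewrite (gen3 W X Y (VsWs _ WVs) (VsWs _ XVs) (VsWs _ YVs)) // Wc Xd Ycd.
Qed.

End CartanDecomposition.

(** * The Killing form and the root spaces *)

Section RootData.
Context (K : numClosedFieldType) (g : vectLieType K).
Implicit Types (x y z h : g) (A B U V W M H : {vspace g}).

(** A root is encoded by its value c at [h0], and its linear form on H by [wt (geig (ad h0) c)].
    Additivity is asked only between nonzero spaces, because the weight of the zero space is 0 by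
    default. *)
Record root_data H h0 : Prop := RootData {
  rd_mem : h0 \in H;
  rd_geig0 : geig (ad h0) 0 = H;
  rd_wt : forall c h, h \in H ->
    (geig (ad h0) c <= geig (ad h) (wt (geig (ad h0) c) h))%VS;
  rd_nilp : forall h, h \in H -> (H <= geig (ad h) 0)%VS;
  rd_add : forall c d, geig (ad h0) c != 0%VS -> geig (ad h0) d != 0%VS ->
    geig (ad h0) (c + d) != 0%VS -> forall h, h \in H ->
    wt (geig (ad h0) (c + d)) h = wt (geig (ad h0) c) h + wt (geig (ad h0) d) h }.

(** It remains to see that E, the zero eigenspace of the generic [h0], is not larger than H. By
    Engel H acts nilpotently on E, so a minimal H-module W strictly above H in E has [H, W] <= H,
    and W <= H because H is its own normalizer. *)
Lemma cartan_root_data H : cartan_subalgebra H -> exists h0, root_data H h0.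
Proof.
move=> cH; have [h0 h0H [wtE nilE addE]] := cartan_weights cH.
exists h0; have H0 := cartan_geig0 cH; split=> //.
have [aH _ normH] := cH; set E := geig (ad h0) 0 in nilE *.
have stE : stable_under H E by apply: stable_geig => x xH; apply: (subvP (H0 h0 h0H)).
have nH : nil_action H E.
  have HE : lspan [set x | x \in H] = H.
    apply/vspaceP => x; apply/idP/idP => [|xH]; last exact: mem_lspan.
    apply/subvP/lspan_subvP => //.
  rewrite -HE; apply: engel => //= x xH; first exact: (subvP (H0 h0 h0H)).
  by move=> v vE; apply/mem_geig0/(subvP (nilE x xH)).
apply/eqP; rewrite eqEsubv H0 // andbT; apply: contraT => nEH.
pose Q W := [/\ (H <= W)%VS, (W <= E)%VS, stable_under H W & ~~ (W <= H)%VS].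
have exQ : exists k, `[< exists2 W, Q W & \dim W = k >].
  by exists (\dim E); apply/asboolP; exists E => //; split=> //; apply: H0.
case: (ex_minnP exQ) => k /asboolP[W [HW WE stW nWH] dW] minW.
have stH : stable_under H H by move=> h hH x xH; rewrite adE; apply: aH.
pose U := (H + lie_span H W)%VS.
have HWW : (lie_span H W <= W)%VS.
  by apply: lie_span_sub => x y xH yW; rewrite -adE stW.
have UW : (U <= W)%VS by rewrite subv_add HW HWW.
have nWU : ~~ (W <= U)%VS.
  by apply: nH => // m mM; split; [apply: stH|apply: stW].
have UH : (U <= H)%VS.
  apply: contraNT nWU => nUH.
  have QU : Q U.
    split=> //; [exact: addvSl|exact: subv_trans UW WE|].
    move=> m mH _ /memv_addP[u uH [v vW ->]]; rewrite linearD memv_add ?(stH m) //= adE.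
    by apply: mem_lie_span => //; apply: (subvP HWW).
  have /minW : `[< exists2 W, Q W & \dim W = \dim U >] by apply/asboolP; exists U.
  by rewrite -dW => dWU; have /eqP <- : U == W by rewrite eqEdim UW.
case/negP: nWH; apply/subvP => x xW; apply: normH => h hH.
rewrite -/(br x h) br_anti memvN; apply: (subvP UH); apply: (subvP (addvSr _ _)).
exact: mem_lie_span.
Qed.

Lemma trv_eq U (f h : 'End(g)) : {in U, f =1 h} -> trv U f = trv U h.
Proof.
move=> fh; rewrite /trv; congr ltr; apply/lfunP => x.
by rewrite !comp_lfunE fh ?memv_proj.
Qed.

Definition killing x y : K := ltr (ad x \o ad y)%VF.

Lemma killingC x y : killing x y = killing y x.
Proof. exact: ltrC. Qed.

Lemma killing_is_scalar x : scalar (killing x).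
Proof. by move=> a y z; rewrite /killing linearP comp_lfunDr -comp_lfunZr linearP. Qed.

HB.instance Definition _ x := GRing.isLinear.Build K g K _ (killing x) (killing_is_scalar x).

Lemma killing_inv x y z : killing (br x y) z = killing x (br y z).
Proof.
rewrite /killing !ad_lie comp_lfunDl comp_lfunDr comp_lfunNl comp_lfunNr !linearB /=.
rewrite !comp_lfunA; congr (_ - _); rewrite [RHS]ltrC !comp_lfunA //.
Qed.

Lemma killing_nilp x y :
  (forall v, exists n, iter n (ad x \o ad y)%VF v = 0) -> killing x y = 0.
Proof.
move=> xy; rewrite /killing -trv_full trv_nilp // => v _; exact: memvf.
Qed.

End RootData.

Section Roots.
Context (K : numClosedFieldType) (g : vectLieType K) (H : {vspace g}) (h0 : g).
Hypothesis rd : root_data H h0.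
Implicit Types (x y z h : g) (U V W : {vspace g}) (b c d : K).

Local Notation E := (geig (ad h0)).
Local Notation a c := (wt (E c)).

Lemma root_E0 : E 0 = H. Proof. exact: rd_geig0 rd. Qed.

Lemma root_shift c d x y : x \in E c -> y \in E d -> br x y \in E (c + d).
Proof. exact: geig_lie. Qed.

Lemma root_stable c h : h \in H -> stablev (ad h) (E c).
Proof. by move=> hH x xc; rewrite adE -[c]add0r root_shift ?root_E0. Qed.

Lemma root_stable_h0 c : stablev (ad h0) (E c).
Proof. exact/root_stable/rd_mem. Qed.

Lemma root_wt0 h : h \in H -> a 0 h = 0.
Proof.
move=> hH; have [->|E0] := eqVneq (E 0) 0%VS; first by rewrite wt0.
symmetry; apply: wt_geig => //; first exact: root_stable.
by rewrite root_E0; apply: rd_nilp rd _ hH.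
Qed.

Lemma root_wt_h0 c : E c != 0%VS -> a c h0 = c.
Proof.
move=> Ec; symmetry; apply: wt_geig => //; first exact: root_stable_h0.
Qed.

Lemma graded_sub U V : stablev (ad h0) U -> (forall c, (U :&: E c <= V)%VS) -> (U <= V)%VS.
Proof.
move=> stU UV; have [s us [_ /(_ U stU) Us]] := spectrum_exists (ad h0).
by apply: subv_trans Us (sum_subvP _) => c _; apply: UV.
Qed.

Lemma root_finite b d : d != 0 -> exists k : nat, E (b + k%:R * d) = 0%VS.
Proof.
move=> d0; have [s us [out _]] := spectrum_exists (ad h0).
apply: contrapT => /forallNP nE.
have inj : injective (fun k : nat => b + k%:R * d).
  move=> i j /addrI /(mulIf d0) /eqP; rewrite eqr_nat => /eqP//.
have := uniq_leq_size (s1 := [seq b + k%:R * d | k <- iota 0 (size s).+1]) (s2 := s).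
rewrite (map_inj_uniq inj) iota_uniq size_map size_iota ltnn => /(_ isT) absurd.
suff: false by []; apply: absurd => _ /mapP[k _ ->]; by apply: contraT => /out /nE.
Qed.

Lemma shift_nilp (f : 'End(g)) d : d != 0 ->
  (forall c x, x \in E c -> f x \in E (c + d)) -> forall x, exists n, iter n f x = 0.
Proof.
move=> d0 fE x; apply/mem_geig0.
suff /subvP/(_ x (memvf x)) : ({:g} <= geig f 0)%VS by [].
apply: graded_sub => [y _|c]; first exact: memvf.
rewrite capfv; apply/subvP => y yc; apply/mem_geig0.
have [k Ek] := root_finite c d0; exists k; apply/eqP; rewrite -memv0 -Ek.
elim: k {Ek} => [|k IHk]; first by rewrite mul0r addr0.
by rewrite -natr1 mulrDl mul1r addrA /= fE.
Qed.

Lemma root_killing_orth c d x y : x \in E c -> y \in E d -> c + d != 0 ->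
  killing x y = 0.
Proof.
move=> xc yd cd0; apply: killing_nilp; apply: (@shift_nilp _ (c + d)) => // b v vb.
by rewrite comp_lfunE !adE addrC -addrA; do 2!apply: root_shift => //.
Qed.

Lemma root_sum_disjoint (s : seq K) c : c \notin s -> uniq s ->
  (E c :&: \sum_(d <- s) E d = 0)%VS.
Proof.
move=> cs us; apply/eqP; rewrite -subv0; apply/subvP => x.
rewrite memv_cap memv0 => /andP[xc xs]; apply/eqP.
exact: geig_sum_disjoint us cs xc xs.
Qed.

Lemma sum_stable (s : seq K) (f : 'End(g)) :
  (forall c x, c \in s -> x \in E c -> f x \in (\sum_(d <- s) E d)%VS) ->
  stablev f (\sum_(d <- s) E d)%VS.
Proof.
move=> fs x xs; rewrite memv_preim; apply: (subvP _ _ xs); apply: sum_subvP => c cs.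
by apply/subvP => y yc; rewrite -memv_preim (fs c).
Qed.

Lemma trv_sum (s : seq K) (f : 'End(g)) : uniq s -> (forall c, stablev f (E c)) ->
  trv (\sum_(c <- s) E c)%VS f = \sum_(c <- s) trv (E c) f.
Proof.
move=> us fE; elim: s us => [|c s IHs] /=; first by rewrite !big_nil trv0.
move=> /andP[cs us]; rewrite !big_cons trv_addv ?IHs ?root_sum_disjoint //.
apply: sum_stable => d x ds xd; apply: (subvP (subv_sum_mem E ds)); exact: fE.
Qed.

(** On E c write ad h = t + f with f nilpotent; the terms f^2 and 2 t f of the square are
    traceless. *)
Lemma trv_sq c h : h \in H ->
  trv (E c) (ad h \o ad h)%VF = (\dim (E c))%:R * a c h ^+ 2.
Proof.
move=> hH; set t := a c h.
have [f fdef] : exists f, f = (ad h - t *: \1%VF)%VF by eexists.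
have -> : (ad h \o ad h = (f \o f) + (2 * t) *: f + t ^+ 2 *: \1)%VF.
  have adE' x : ad h x = f x + t *: x by rewrite fdef shiftE subrK.
  apply/lfunP => x; rewrite !add_lfunE !scale_lfunE !comp_lfunE id_lfunE !adE'.
  by rewrite raddfD /= linearZ /= scalerDr scalerA mulrDl mul1r scalerDl !addrA.
have fE : stablev f (E c) by rewrite fdef; apply/stablev_shift/root_stable.
have fn x : x \in E c -> exists n, iter n f x = 0.
  by move=> xc; rewrite fdef; apply/mem_geig/(subvP (rd_wt rd c hH)).
rewrite !linearD !linearZ /= trv_id (trv_nilp fE fn) mulr0 addr0.
rewrite trv_nilp ?add0r 1?mulrC //.
  by move=> x xc; rewrite comp_lfunE !fE.
move=> x xc; have [n xn] := fn x xc; exists n.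
suff -> : forall m y, iter m (f \o f)%VF y = iter (m + m) f y.
  by apply: iter_lfun_eq0 xn; rewrite leq_addr.
by elim=> // m IHm y; rewrite addSn addnS !iterS -IHm comp_lfunE.
Qed.

End Roots.

(** * Root strings and the values of weights on coroots *)

Section RootStrings.
Context (K : numClosedFieldType) (g : vectLieType K) (H : {vspace g}) (h0 : g).
Hypothesis rd : root_data H h0.
Implicit Types (x y z h : g) (U V W : {vspace g}) (b c d : K).

Local Notation E := (geig (ad h0)).
Local Notation a c := (wt (E c)).

(** The diagonal case is [trv_sq]; polarizing it avoids a simultaneous triangularization of [ad h]
    and [ad h']. *)
Lemma killing_weights : exists2 s : seq K, (forall c, c \notin s -> E c = 0%VS) &
  forall h h', h \in H -> h' \in H ->
    killing h h' = \sum_(c <- s) (\dim (E c))%:R * (a c h * a c h').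
Proof.
have [s us [out /(_ fullv) gs]] := spectrum_exists (ad h0); exists s => //.
have gE : (\sum_(c <- s) E c)%VS = {:g}%VS.
  apply/eqP; rewrite eqEsubv subvf /=.
  apply: subv_trans (gs _) (sum_subvP _) => [x _|c cs]; first exact: memvf.
  by rewrite capfv subv_sum_mem.
have sq h : h \in H -> killing h h = \sum_(c <- s) (\dim (E c))%:R * (a c h * a c h).
  move=> hH; rewrite /killing -trv_full -gE trv_sum //.
    by apply: eq_bigr => c _; rewrite (trv_sq rd).
  by move=> c x xc; rewrite comp_lfunE; do 2!apply: (root_stable rd) => //.
move=> h h' hH h'H; have hh' : h + h' \in H by rewrite memvD.
have := sq _ hh'; rewrite raddfD /= ![killing (h + h') _]killingC !raddfD /=.
rewrite (sq h) // (sq h') // [killing h' h]killingC.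
set S1 := \sum_(c <- s) _; set S2 := \sum_(c <- s) _; set S := (X in _ = X -> _).
move=> eS; apply: (@mulfI _ 2%:R); first by rewrite pnatr_eq0.
have -> : 2%:R * killing h h' = S - S1 - S2 by rewrite -eS; ring.
rewrite /S /S1 /S2 -!sumrB big_distrr /=; apply: eq_bigr => c _.
rewrite !linearD /=; ring.
Qed.

Lemma killing_wt_eq0 h h' : h \in H -> h' \in H ->
  (forall c, E c != 0%VS -> a c h = 0) -> killing h h' = 0.
Proof.
move=> hH h'H ah; have [s _ ->] := killing_weights => //.
rewrite big1 // => c _; have [->|Ec] := eqVneq (E c) 0%VS; first by rewrite dimv0 mul0r.
by rewrite ah // mul0r mulr0.
Qed.

Lemma chain_wt b c h k : E c != 0%VS -> h \in H ->
  (forall i, (i <= k)%N -> E (b + i%:R * c) != 0%VS) ->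
  a (b + k%:R * c) h = a b h + k%:R * a c h.
Proof.
move=> Ec hH; elim: k => [|k IHk] Ei; first by rewrite !mul0r !addr0.
have := Ei k.+1 (leqnn _); rewrite -natr1 mulrDl mul1r addrA => Ek.
have Ek' : E (b + k%:R * c) != 0%VS by apply: Ei.
rewrite (rd_add rd Ek' Ec Ek hH) IHk; last by move=> i ik; apply: Ei; lia.
by rewrite mulrDl mul1r addrA.
Qed.

(* A piece of the [c]-string through [b]; when unbroken, weights are affine along it. *)
Definition chain b c m : {vspace g} := (\sum_(i < m) E (b + i%:R * c)%R)%VS.

Lemma chain_seq b c m :
  chain b c m = (\sum_(d <- [seq (b + i%:R * c)%R | i <- iota 0 m]) E d)%VS.
Proof. by rewrite big_map -[in iota 0 m](subn0 m) big_mkord. Qed.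

Lemma chain_sub b c m V : (forall i, (i < m)%N -> (E (b + i%:R * c)%R <= V)%VS) ->
  (chain b c m <= V)%VS.
Proof. by move=> EV; apply/subv_sumP => i _; apply: EV. Qed.

Lemma sub_chain b c m i : (i < m)%N -> (E (b + i%:R * c)%R <= chain b c m)%VS.
Proof. by move=> im; apply: (sumv_sup (Ordinal im)). Qed.

Lemma chain_stable b c m h : h \in H -> stablev (ad h) (chain b c m).
Proof.
move=> hH v vU; rewrite memv_preim; apply: (subvP _ _ vU).
apply: chain_sub => i im; apply/subvP => w wi; rewrite -memv_preim.
by apply: (subvP (sub_chain _ _ im)); apply: (root_stable rd).
Qed.

Lemma chain_up b c m x : E (b + m%:R * c) = 0%VS -> x \in E c ->
  stablev (ad x) (chain b c m).
Proof.
move=> Em xc v vU; rewrite memv_preim; apply: (subvP _ _ vU).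
apply: chain_sub => i im; apply/subvP => w wi; rewrite -memv_preim adE.
have wE : br x w \in E (b + i.+1%:R * c).
  by rewrite -natr1 mulrDl mul1r addrA addrC; apply: root_shift.
have [i1m|i1m] := ltnP i.+1 m; first exact: (subvP (sub_chain _ _ i1m)).
have im1 : i.+1 = m by lia.
by move: wE; rewrite im1 Em memv0 => /eqP->; rewrite mem0v.
Qed.

Lemma chain_down b c m y i w : y \in E (- c) -> (i.+1 < m)%N ->
  w \in E (b + i.+1%:R * c) -> br y w \in chain b c m.
Proof.
move=> yc im wi; apply: (subvP (sub_chain _ _ (ltnW im))).
have -> : b + i%:R * c = - c + (b + i.+1%:R * c) by rewrite -natr1; ring.
exact: root_shift.
Qed.

Lemma chain_trace b c m h : c != 0 -> E c != 0%VS -> h \in H ->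
  (forall i, (i < m)%N -> E (b + i%:R * c) != 0%VS) ->
  trv (chain b c m) (ad h) =
    \sum_(i < m) (\dim (E (b + i%:R * c)))%:R * (a b h + i%:R * a c h).
Proof.
move=> c0 Ec hH Ei; rewrite chain_seq trv_sum; last first.
- by move=> d; apply: (root_stable rd).
- rewrite map_inj_uniq ?iota_uniq // => i j /addrI/(mulIf c0)/eqP.
  by rewrite eqr_nat => /eqP.
rewrite big_map -[in iota 0 m](subn0 m) big_mkord; apply: eq_bigr => i _.
rewrite trv_wt chain_wt // => j ji; apply: Ei.
exact: leq_ltn_trans ji (ltn_ord i).
Qed.

(** The trace of ad [x, y] on the c-string through b is 0 and also equals N a_b' + M a_c, with b'
    the bottom of the string and N > 0, M natural numbers made of dimensions. *)
Lemma string_wt b c x y : c != 0 -> E b != 0%VS -> x \in E c -> y \in E (- c) ->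
  exists2 r, r \is Num.real & a b (br x y) = r * a c (br x y).
Proof.
move=> c0 Eb xc yc; have [Ec|Ec] := eqVneq (E c) 0%VS.
  exists 0; rewrite ?real0 //; move: xc; rewrite Ec memv0 => /eqP->.
  by rewrite br0l linear0 mul0r.
set t := br x y; have tH : t \in H.
  by rewrite -(root_E0 rd) -(subrr c); apply: root_shift.
have exp : exists k, E (b + k%:R * - c) == 0%VS.
  by have [|k Ek] := root_finite h0 b (d := - c); rewrite ?oppr_eq0 //; exists k; apply/eqP.
case: (ex_minnP exp) => -[|p] /eqP Ep minp; first by rewrite mul0r addr0 in Ep; rewrite Ep eqxx in Eb.
(* [b'] is the bottom of the unbroken c-string through b; [m] below is the length of that string. *)
pose b' := b - p%:R * c.
have Ei i : (i <= p)%N -> E (b' + i%:R * c) != 0%VS.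
  move=> ip; have -> : b' + i%:R * c = b + (p - i)%:R * - c by rewrite /b' natrB //; ring.
  by apply/negP => /minp; lia.
have exm : exists k, E (b' + k%:R * c) == 0%VS.
  by have [k Ek] := root_finite h0 b' c0; exists k; apply/eqP.
case: (ex_minnP exm) => m /eqP Em minm.
have Ei' i : (i < m)%N -> E (b' + i%:R * c) != 0%VS.
  by move=> im; apply/negP => /minm; lia.
have pm : (p < m)%N.
  by rewrite ltnNge; apply/negP => mp; move: (Ei m mp); rewrite Em eqxx.
have bE : b = b' + p%:R * c by rewrite /b'; ring.
have := chain_trace c0 Ec tH Ei'.
(* [chain b' c m] is stable under [x] and [y], so that [ad [x, y]] has trace 0 on it. *)
have -> : trv (chain b' c m) (ad t) = 0.
  rewrite /t ad_lie; apply: trv_comm; first exact: chain_up.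
  move=> v vU; rewrite memv_preim; apply: (subvP _ _ vU).
  apply: chain_sub => -[|i] im; apply/subvP => w wi; rewrite -memv_preim adE.
    suff -> : br y w = 0 by rewrite mem0v.
    apply/eqP; rewrite -memv0 -Ep; have -> : b + p.+1%:R * - c = - c + b'.
      by rewrite /b' -natr1; ring.
    by rewrite mul0r addr0 in wi; exact: root_shift yc wi.
  exact: (chain_down yc im wi).
pose n i := (\dim (E (b' + i%:R * c)))%:R : K.
have -> : \sum_(i < m) (\dim (E (b' + i%:R * c)))%:R * (a b' t + i%:R * a c t)
   = (\sum_(i < m) n i) * a b' t + (\sum_(i < m) n i * i%:R) * a c t.
  rewrite !big_distrl -big_split /=; apply: eq_bigr => i _.
  by rewrite /n; ring.
set N := \sum_(i < m) n i; set M := \sum_(i < m) _.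
have N0 : N != 0.
  rewrite psumr_neq0; last by move=> i _; rewrite ler0n.
  apply/hasP; exists (Ordinal pm); rewrite ?mem_index_enum //=.
  by rewrite /n ltr0n lt0n dimv_eq0 Ei'.
have realN : N \is Num.real by apply: sum_real => i _; rewrite realn.
have realM : M \is Num.real by apply: sum_real => i _; rewrite rpredM ?realn.
move/esym/eqP; rewrite addr_eq0 => /eqP NM.
have ab' : a b' t = - (M / N) * a c t.
  by apply: (mulfI N0); rewrite NM; field.
exists (p%:R - M / N); first by rewrite rpredB ?realn // rpred_div.
rewrite {1}bE chain_wt // ab'; ring.
Qed.

End RootStrings.

(** * Semisimplicity implies a nondegenerate Killing form *)

Section Semisimple.
Context (K : numClosedFieldType) (g : vectLieType K) (H : {vspace g}) (h0 : g).
Hypothesis rd : root_data H h0.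
Hypothesis ss : lie_semisimple {:g}%VS.
Implicit Types (x y z h e f : g) (D U V W : {vspace g}) (b c d : K).

Local Notation E := (geig (ad h0)).
Local Notation a c := (wt (E c)).

Definition kperp x : {vspace g} := lspan [set y | killing x y = 0].

Lemma mem_kperp x y : y \in kperp x <-> killing x y = 0.
Proof.
apply: (mem_lspan_closed (S := [set y | killing x y = 0])) => /=.
  exact: linear0.
by move=> k u w u0 w0; rewrite linearP /= u0 w0 mulr0 addr0.
Qed.

Definition wt_kernel : {vspace g} := lspan [set h | h \in H /\ forall b, a b h = 0].

Lemma mem_wt_kernel h : h \in wt_kernel <-> h \in H /\ forall b, a b h = 0.
Proof.
apply: (mem_lspan_closed (S := [set h | h \in H /\ forall b, a b h = 0])) => /=.
  by split=> [|b]; rewrite ?mem0v ?linear0.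
move=> k u w [uH u0] [wH w0]; split=> [|b]; first by rewrite memvD ?memvZ.
by rewrite linearP /= u0 w0 mulr0 addr0.
Qed.

Lemma wt_lie0 b x y : x \in H -> y \in H -> a b (br x y) = 0.
Proof.
move=> xH yH; rewrite /wt ad_lie trv_comm ?mul0r //; exact: (root_stable rd).
Qed.

(* The ratios [a d t / a c t] are real, so the positive sum of their squares   *)
(* cannot vanish.                                                              *)
Lemma wt_coroot0 c x y : c != 0 -> x \in E c -> y \in E (- c) ->
  killing (br x y) (br x y) = 0 -> forall b, a b (br x y) = 0.
Proof.
move=> c0 xc yc; set t := br x y => tt b.
have [Eb|Eb] := eqVneq (E b) 0%VS; first by rewrite Eb wt0.
have [Ec|Ec] := eqVneq (E c) 0%VS.
  have x0 : x = 0 by apply/eqP; rewrite -memv0 -Ec.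
  by rewrite /t x0 br0l linear0.
have tH : t \in H by rewrite -(root_E0 rd) -(subrr c); apply: root_shift.
suff ac : a c t = 0 by have [r _ ->] := string_wt rd c0 Eb xc yc; rewrite ac mulr0.
have [//|ac] := eqVneq (a c t) 0.
have [s out ks] := killing_weights rd.
have : \sum_(d <- s) (\dim (E d))%:R * (a d t / a c t) ^+ 2 = 0.
  transitivity (killing t t / a c t ^+ 2); last by rewrite tt mul0r.
  rewrite ks // big_distrl /=; apply: eq_bigr => d _.
  by rewrite expr_div_n expr2 !mulrA.
have pos d : 0 <= (\dim (E d))%:R * (a d t / a c t) ^+ 2.
  have [Ed|Ed] := eqVneq (E d) 0%VS; first by rewrite Ed dimv0 mul0r.
  have [r rR ->] := string_wt rd c0 Ed xc yc.
  by rewrite mulfK // mulr_ge0 ?ler0n // real_exprn_even_ge0.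
have cs : c \in s by apply: contraNT Ec => /out ->.
move/eqP; rewrite psumr_eq0 // => /allP/(_ c cs).
by rewrite divff // expr1n mulr1 pnatr_eq0 dimv_eq0 (negPf Ec).
Qed.

Definition ideal (D : {vspace g}) := forall x y, y \in D -> br x y \in D.

Lemma ideal_lie_span D : ideal D -> ideal (lie_span D D).
Proof.
move=> iD x; apply: lspan_lier => _ [u [v [uD vD ->]]].
by rewrite br_der memvD // mem_lie_span // iD.
Qed.

Lemma ideal_sub_lie_ideal D : ideal D -> lie_ideal {:g}%VS D.
Proof. by move=> iD; split=> [|x y _]; [exact: subvf | exact: iD]. Qed.

Lemma ideal_stable D : ideal D -> stablev (ad h0) D.
Proof. by move=> iD x xD; rewrite adE iD. Qed.

(** D is spanned by brackets of its homogeneous elements. Those landing in H come from two elements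
    of H or from opposite root spaces, and all weights vanish on them by [wt_lie0] and
    [wt_coroot0]. *)
Lemma perfect_ideal_wt0 D : ideal D -> (D <= lie_span D D)%VS ->
  (forall x y, x \in D -> killing x y = 0) ->
  forall h b, h \in D -> h \in H -> a b h = 0.
Proof.
move=> iD perfD Dk.
have [s us [out _]] := spectrum_exists (ad h0).
pose s' := [seq d <- s | d != 0].
suff DX : (D <= wt_kernel + \sum_(d <- s') E d)%VS.
  move=> h b hD hH.
  have /memv_addP[u uX [v vs hE]] := subvP DX h hD.
  have v0 : v = 0.
    apply: (@geig_sum_disjoint _ _ (ad h0) s' 0) vs.
    - exact: filter_uniq.
    - by rewrite mem_filter eqxx.
    - have -> : v = h - u by rewrite hE addrC addKr.
      by rewrite (root_E0 rd) memvB //; case/mem_wt_kernel: uX.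
  by rewrite hE v0 addr0; case/mem_wt_kernel: uX.
apply: subv_trans perfD _; set X := (_ + _)%VS.
suff XD x c : x \in (D :&: E c)%VS -> (D <= ad x @^-1: X)%VS.
  apply: lie_span_sub => x y xD yD.
  rewrite br_anti memvN -adE memv_preim; apply: (subvP _ _ xD).
  apply: graded_sub (ideal_stable iD) _ => c; apply/subvP => z zc.
  rewrite -memv_preim adE br_anti memvN -adE memv_preim.
  exact: (subvP (XD z c zc)).
rewrite memv_cap => /andP[xD xc].
apply: graded_sub (ideal_stable iD) _ => d; apply/subvP => y.
rewrite memv_cap => /andP[yD yd]; rewrite -memv_preim adE.
have xy := root_shift xc yd.
have [cd0|cd0] := eqVneq (c + d) 0; last first.
  have [cds|/out Ecd] := boolP (c + d \in s); last first.
    by move: xy; rewrite Ecd memv0 => /eqP->; rewrite mem0v.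
  apply: (subvP (addvSr _ _)); apply: (subvP (subv_sum_mem E _)) xy.
  by rewrite mem_filter cd0.
apply: (subvP (addvSl _ _)); apply/mem_wt_kernel.
rewrite cd0 (root_E0 rd) in xy; split=> // b.
have dE : d = - c by apply/eqP; rewrite -addr_eq0 addrC cd0.
have [c0|c0] := eqVneq c 0.
  apply: wt_lie0; first by rewrite -(root_E0 rd) -c0.
  by rewrite -(root_E0 rd) -[0]oppr0 -c0 -dE.
apply: (wt_coroot0 c0 xc); first by rewrite -dE.
by apply: Dk; apply: iD.
Qed.

(** The homogeneous elements of D act nilpotently on [g]: root vectors shift eigenvalues, and
    elements of H have all weights 0. By Engel, D = [D, D] is impossible unless D = 0. *)
Lemma no_perfect_ideal D : ideal D -> (D <= lie_span D D)%VS ->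
  (forall x y, x \in D -> killing x y = 0) -> D = 0%VS.
Proof.
move=> iD perfD Dk; have wt_eq0 := perfect_ideal_wt0 iD perfD Dk.
pose S (x : g) := exists c, x \in (D :&: E c)%VS.
have SD : lspan S = D.
  apply/eqP; rewrite eqEsubv; apply/andP; split.
    by apply/lspan_subvP => x [c]; rewrite memv_cap => /andP[].
  apply: graded_sub (ideal_stable iD) _ => c; apply/subvP => x xc.
  by apply: mem_lspan; exists c.
have nD : nil_action D {:g}.
  rewrite -SD; apply: engel => [x y [c] xc [d] yd|x _|x [c] xc v _].
  - move: xc yd; rewrite !memv_cap => /andP[xD xc] /andP[yD yd].
    by exists (c + d); rewrite memv_cap iD //; apply: root_shift.
  - exact: memvf.
  move: xc; rewrite memv_cap => /andP[xD xc].
  have [c0|c0] := eqVneq c 0; last first.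
    by apply: (shift_nilp (h0 := h0) c0) => d z zd; rewrite adE addrC; apply: root_shift.
  have xH : x \in H by rewrite -(root_E0 rd) -c0.
  apply/mem_geig0; apply: (subvP _ _ (memvf v)).
  apply: graded_sub => [z _|d]; first exact: memvf.
  by rewrite capfv -[X in geig (ad x) X](wt_eq0 x d xD xH); apply: (rd_wt rd).
apply/eqP; rewrite -subv0; apply: contraT => D0.
have /negP[] : ~~ (D <= 0 + lie_span D D)%VS.
  apply: nD => //; [exact: sub0v|exact: subvf|].
  move=> m mD; split=> x; last by rewrite adE; apply: iD.
  by rewrite !memv0 => /eqP->; rewrite linear0.
by rewrite add0v.
Qed.

(** A minimal nonzero ideal D in the radical of the form is not abelian by semisimplicity, so [D, D]
    = D by minimality, which [no_perfect_ideal] excludes. *)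
Lemma killing_nondeg x : (forall y, killing x y = 0) -> x = 0.
Proof.
move=> xk; apply/eqP; rewrite -memv0.
pose N := lspan [set x | forall y, killing x y = 0].
have memN z : z \in N <-> forall y, killing z y = 0.
  apply: (mem_lspan_closed (S := [set x | forall y, killing x y = 0])) => /=.
    by move=> y; rewrite killingC linear0.
  move=> k u w u0 w0 y; rewrite killingC linearP /=.
  by rewrite !(killingC y) u0 w0 mulr0 addr0.
have iN : ideal N.
  move=> u v /memN v0; apply/memN => y.
  by rewrite br_anti -scaleN1r killingC linearZ /= killingC killing_inv v0 mulr0.
suff N0 : N = 0%VS by have := (memN x).2 xk; rewrite N0.
apply/eqP; apply: contraT => N0.
have exD : exists k, `[< exists2 D, [/\ ideal D, (D <= N)%VS & D != 0%VS] & \dim D = k >].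
  by exists (\dim N); apply/asboolP; exists N.
case: (ex_minnP exD) => k /asboolP[D [iD DN D0] dD] minD.
have iDD := ideal_lie_span iD.
have DDD : (lie_span D D <= D)%VS by apply: lie_span_sub => u v _; apply: iD.
have DD0 : lie_span D D != 0%VS.
  apply: contra_neq D0 => DD0; apply: ss.2; first exact: ideal_sub_lie_ideal.
  by exists 1%N.
have perfD : (D <= lie_span D D)%VS.
  have /minD : `[< exists2 D', [/\ ideal D', (D' <= N)%VS & D' != 0%VS]
                     & \dim D' = \dim (lie_span D D) >].
    apply/asboolP; exists (lie_span D D) => //; split=> //.
    exact: subv_trans DDD DN.
  by rewrite -dD => dDD; have /eqP -> : lie_span D D == D by rewrite eqEdim DDD.
case/negP: D0; apply/eqP; apply: no_perfect_ideal => // u v uD.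
by apply: (memN u).1; apply: (subvP DN).
Qed.

End Semisimple.

(** * Root spaces are lines *)

Section RootSpaces.
Context (K : numClosedFieldType) (g : vectLieType K) (H : {vspace g}) (h0 : g).
Hypothesis rd : root_data H h0.
Hypothesis nondeg : forall x : g, (forall y, killing x y = 0) -> x = 0.
Implicit Types (x y z h e f : g) (D U V W : {vspace g}) (b c d : K).

Local Notation E := (geig (ad h0)).
Local Notation a c := (wt (E c)).

Lemma killing_opp c x : x \in E c -> (forall y, y \in E (- c) -> killing x y = 0) -> x = 0.
Proof.
move=> xc xk; apply: nondeg => y; apply/mem_kperp; apply: (subvP _ _ (memvf y)).
apply: (graded_sub (h0 := h0)) => [z _|d]; first exact: memvf.
rewrite capfv; apply/subvP => z zd; apply/mem_kperp.
have [cd0|cd0] := eqVneq (c + d) 0.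
  by apply: xk; have -> : - c = d by apply/eqP; rewrite eq_sym -addr_eq0 addrC cd0.
exact: root_killing_orth xc zd cd0.
Qed.

Lemma wt_inj h : h \in H -> (forall c, E c != 0%VS -> a c h = 0) -> h = 0.
Proof.
move=> hH ah; apply: (@killing_opp 0); first by rewrite (root_E0 rd).
by rewrite oppr0 (root_E0 rd) => y yH; apply: (killing_wt_eq0 rd).
Qed.

(** Weights are normalized traces, so they vanish on [H, H], and by nondegeneracy they separate the
    points of H. *)
Lemma cartan_abelian h h' : h \in H -> h' \in H -> br h h' = 0.
Proof.
move=> hH h'H; apply: wt_inj; last by move=> c _; apply: (wt_lie0 rd).
by rewrite -adE -(root_E0 rd); apply: (root_stable rd); rewrite ?(root_E0 rd).
Qed.

(** In a minimal nonzero H-stable subspace every eigenspace of [ad h] is H-stable because H is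
    abelian; hence it is the whole subspace. *)
Lemma common_eigenvector c : E c != 0%VS ->
  exists f, [/\ f \in E c, f != 0 & forall h, h \in H -> br h f = a c h *: f].
Proof.
move=> Ec; pose Q W := [/\ (W <= E c)%VS, W != 0%VS & stable_under H W].
have exQ : exists k, `[< exists2 W, Q W & \dim W = k >].
  exists (\dim (E c)); apply/asboolP; exists (E c) => //; split=> //.
  by move=> h hH; apply: (root_stable rd).
case: (ex_minnP exQ) => k /asboolP[W [Wc W0 stW] dW] minW.
have scal h : h \in H -> exists t, forall x, x \in W -> br h x = t *: x.
  move=> hH; have [t [x [xW x0 hx]]] := stablev_eigenvector (stW h hH) W0.
  exists t; pose L := (W :&: lker (ad h - t *: \1%VF)%VF)%VS.
  have LW : (L <= W)%VS by apply: capvSl.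
  have QL : Q L.
    split; first exact: subv_trans LW Wc.
      apply: contraNneq x0 => L0; rewrite -memv0 -L0 memv_cap xW memv_ker shiftE.
      by rewrite hx subrr eqxx.
    move=> h' h'H z; rewrite !memv_cap !memv_ker !shiftE !adE => /andP[zW].
    rewrite subr_eq0 => /eqP hz.
    have -> : br h' z \in W by rewrite -adE; apply: stW.
    by rewrite br_der (cartan_abelian hH h'H) br0l add0r hz brZr subrr eqxx.
  have /minW : `[< exists2 W, Q W & \dim W = \dim L >] by apply/asboolP; exists L.
  rewrite -dW => dWL; have WL : W == L by rewrite eq_sym eqEdim LW.
  move=> y; rewrite (eqP WL) memv_cap memv_ker shiftE adE subr_eq0.
  by case/andP=> _ /eqP.
exists (vpick W); split; rewrite ?vpick0 ?(subvP Wc) ?memv_pick //.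
move=> h hH; have [t ht] := scal h hH; rewrite ht ?memv_pick //.
have [-> //|th] := eqVneq t (a c h).
have v0 : vpick W = 0.
  apply: (geig_disjoint (f := ad h) th).
    by apply/mem_geig; exists 1%N; rewrite /= shiftE adE ht ?memv_pick // subrr.
  by apply: (subvP (rd_wt rd c hH)); rewrite (subvP Wc) ?memv_pick.
by rewrite v0 !scaler0.
Qed.

(** With killing f e = 1, t = [f, e] represents the root through the Killing form. If the root
    vanished at t, so would all weights by [string_wt], forcing c = killing t h0 = 0. The dimension
    is obtained on the side opposite to f; [root_dim1] exchanges c and -c. *)
Lemma root_pair c : c != 0 -> E c != 0%VS -> exists e f,
  [/\ e \in E (- c), f \in E c, e != 0, f != 0 & a c (br f e) != 0] /\
  [/\ \dim (E (- c)) = 1%N & forall h, h \in H -> br h f = a c h *: f].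
Proof.
move=> c0 Ec; have [f [fc f0 hf]] := common_eigenvector Ec.
have [e0 e0c e0k] : exists2 e, e \in E (- c) & killing f e != 0.
  apply: contrapT => nE; case/negP: f0; apply/eqP; apply: killing_opp fc _ => y yc.
  by apply: contrapT => /eqP k0; apply: nE; exists y.
pose e := (killing f e0)^-1 *: e0.
have ec : e \in E (- c) by rewrite memvZ.
have ke : killing f e = 1 by rewrite linearZ /= mulVf.
have e0' : e != 0 by apply: contra_eq_neq ke => ->; rewrite linear0 eq_sym oner_eq0.
have Emc : E (- c) != 0%VS by apply: contraNneq e0' => E0; rewrite -memv0 -E0.
set t := br f e; have tE0 : t \in E 0 by rewrite -(subrr c); apply: root_shift.
have tH : t \in H by rewrite -(root_E0 rd).
have tk h : h \in H -> killing t h = a c h.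
  move=> hH; rewrite killingC /t -killing_inv hf // killingC linearZ /= killingC ke.
  by rewrite mulr1.
have act : a c t != 0.
  have := c0; apply: contra_neq => ac0; rewrite -(root_wt_h0 rd Ec) -tk ?(rd_mem rd) //.
  apply: (killing_wt_eq0 rd) => //; first exact: rd_mem rd.
  by move=> b Eb; have [r _ ->] := string_wt rd c0 Eb fc ec; rewrite -/t ac0 mulr0.
exists e, f; split; split=> //.
have t0 : t != 0 by apply: contraNneq act => ->; rewrite linear0.
have E0 : E 0 != 0%VS by apply: contraNneq t0 => E0; rewrite -memv0 -E0.
have mc0 : - c != 0 by rewrite oppr_eq0.
have exm : exists k, E (0 + k%:R * - c) == 0%VS.
  by have [k Ek] := root_finite h0 0 mc0; exists k; apply/eqP.
case: (ex_minnP exm) => m /eqP Em minm.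
have Ei i : (i < m)%N -> E (0 + i%:R * - c) != 0%VS.
  by move=> im; apply/negP => Ei0; have := minm i Ei0; rewrite leqNgt im.
have m1 : (1 < m)%N.
  case: m {minm Ei} Em => [|[|//]]; first by rewrite mul0r addr0 => /eqP; rewrite (negPf E0).
  by rewrite mul1r add0r => /eqP; rewrite (negPf Emc).
(* The trace of [ad t] on [<[f]> + C] vanishes; this forces sum_i i * dim E_(-ic) = 1. *)
pose C := chain h0 0 (- c) m.
have E0C : (E 0 <= C)%VS.
  by rewrite -[X in E X](addr0 0) -[X in E (0 + X)](mul0r (- c)) (sub_chain h0 0 (- c) (ltnW m1)).
have dis : (<[f]> :&: C = 0)%VS.
  apply/eqP; rewrite -subv0; apply/subvP => x; rewrite memv_cap memv0 => /andP[xf xC].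
  have xc : x \in E c by case/vlineP: xf => k ->; rewrite memvZ.
  apply/eqP; apply: (geig_sum_disjoint _ _ xc (s := [seq 0 + i%:R * - c | i <- iota 0 m])).
  - rewrite map_inj_uniq ?iota_uniq // => i j /addrI/(mulIf mc0)/eqP.
    by rewrite eqr_nat => /eqP.
  - apply/mapP => -[i _] /eqP; rewrite add0r mulrN -addr_eq0 -[X in X + _]mul1r -mulrDl.
    by rewrite mulf_eq0 (negPf c0) orbF nat1r pnatr_eq0.
  - by rewrite -chain_seq.
have st_e : stablev (ad e) (<[f]> + C)%VS.
  move=> _ /memv_addP[_ /vlineP[k ->] [v vC ->]]; rewrite linearD memvD //.
    rewrite linearZ memvZ //= adE br_anti memvN -/t.
    by apply: (subvP (addvSr _ _)); apply: (subvP E0C).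
  by apply: (subvP (addvSr _ _)); apply: chain_up Em ec v vC.
have st_f : stablev (ad f) (<[f]> + C)%VS.
  move=> _ /memv_addP[_ /vlineP[k ->] [v vC ->]]; rewrite linearD memvD //.
    by rewrite linearZ /= adE brxx scaler0 mem0v.
  rewrite memv_preim; apply: (subvP _ _ vC).
  apply: chain_sub => -[|i] im; apply/subvP => w wi; rewrite -memv_preim adE.
    rewrite mul0r addr0 (root_E0 rd) in wi.
    rewrite br_anti memvN hf // memvZ //.
    by apply: (subvP (addvSl _ _)); apply: memv_line.
  apply: (subvP (addvSr _ _)); apply: (chain_down _ im wi).
  by rewrite opprK.
have st_tf : stablev (ad t) <[f]>.
  by move=> _ /vlineP[k ->]; rewrite linearZ memvZ //= adE hf // memvZ // memv_line.
have wtm : a (- c) t = - a c t.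
  have := rd_add rd Ec Emc; rewrite subrr => /(_ E0 t tH); rewrite (root_wt0 rd) //.
  by move/esym/eqP; rewrite addrC addr_eq0 => /eqP.
have := trv_comm st_f st_e; rewrite -ad_lie -/t trv_addv //; last exact: (chain_stable rd).
have -> : trv <[f]> (ad t) = a c t.
  have -> : trv <[f]> (ad t) = trv <[f]> (a c t *: \1%VF).
    by apply: trv_eq => _ /vlineP[k ->]; rewrite scale_lfunE id_lfunE adE brZr hf // !scalerA mulrC.
  by rewrite linearZ /= trv_line // mulr1.
rewrite (chain_trace rd mc0 Emc tH Ei) (root_wt0 rd) // wtm.
pose n i := \dim (E (0 + i%:R * - c)).
have -> : \sum_(i < m) (\dim (E (0 + i%:R * - c)))%:R * (0 + i%:R * - a c t)
   = - (a c t * (\sum_(i < m) n i * i)%:R).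
  rewrite natr_sum big_distrr /= -sumrN; apply: eq_bigr => i _.
  by rewrite /n natrM; ring.
move/eqP; rewrite -[X in X - _]mulr1 -mulrBr mulf_eq0 (negPf act) /= subr_eq0 eq_sym pnatr_eq1.
rewrite (bigD1 (Ordinal m1)) //= muln1 => /eqP sum1.
have n1 : n 1%N = \dim (E (- c)) by rewrite /n mul1r add0r.
have : (0 < \dim (E (- c)))%N by rewrite lt0n dimv_eq0.
move: sum1; rewrite n1.
by move: (\dim _) (\sum_(i < m | _) _)%N => [|[|k]] S.
Qed.

Lemma root_dim1 c : c != 0 -> E c != 0%VS -> \dim (E c) = 1%N /\ E (- c) != 0%VS.
Proof.
move=> c0 Ec; have [e [f [[ec _ e0 _ _] _]]] := root_pair c0 Ec.
have Emc : E (- c) != 0%VS by apply: contraNneq e0 => E0; rewrite -memv0 -E0.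
have mc0 : - c != 0 by rewrite oppr_eq0.
by split=> //; have [e' [f' [_ [+ _]]]] := root_pair mc0 Emc; rewrite opprK.
Qed.

Lemma root_line c x : c != 0 -> x \in E c -> x != 0 -> E c = <[x]>%VS.
Proof.
move=> c0 xc x0; have Ec : E c != 0%VS by apply: contraNneq x0 => E0; rewrite -memv0 -E0.
apply/esym/eqP; rewrite eqEdim dim_vline x0 (root_dim1 c0 Ec).1 leqnn andbT.
by rewrite -memvE.
Qed.

Lemma root_eigen c x h : c != 0 -> x \in E c -> h \in H -> br h x = a c h *: x.
Proof.
move=> c0 xc hH; have [->|x0] := eqVneq x 0; first by rewrite br0r scaler0.
have Ec : E c != 0%VS by apply: contraNneq x0 => E0; rewrite -memv0 -E0.
have [e [f [[_ fc _ f0 _] [_ hf]]]] := root_pair c0 Ec.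
have /vlineP[k ->] : x \in <[f]>%VS by rewrite -(root_line c0 fc f0).
by rewrite brZr hf // !scalerA mulrC.
Qed.

Lemma root_coroot c x y : c != 0 -> x \in E c -> y \in E (- c) -> x != 0 -> y != 0 ->
  a c (br x y) != 0.
Proof.
move=> c0 xc yc x0 y0.
have Ec : E c != 0%VS by apply: contraNneq x0 => E0; rewrite -memv0 -E0.
have [e [f [[ec fc e0 f0 act] _]]] := root_pair c0 Ec.
have mc0 : - c != 0 by rewrite oppr_eq0.
have /vlineP[k xE] : x \in <[f]>%VS by rewrite -(root_line c0 fc f0).
have /vlineP[l yE] : y \in <[e]>%VS by rewrite -(root_line mc0 ec e0).
move: x0 y0; rewrite xE yE !scaler_eq0 !negb_or.
move=> /andP[k0 _] /andP[l0 _]; rewrite brZl brZr scalerA linearZ /=.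
by apply: mulf_neq0 => //; apply: mulf_neq0.
Qed.

End RootSpaces.

(** * Coefficients of conformal averaging operators *)

Section Coefficients.
Context (K : numFieldType) (V : vectType K).
Implicit Types (p : vpoly1 V) (W : {vspace V}).

Lemma sum_msupp p (F : nat -> V) N : (forall i, p@_i = 0 -> F i = 0) ->
  (forall i, (N <= i)%N -> F i = 0) -> \sum_(i <- msupp p) F i = \sum_(i < N) F i.
Proof.
move=> Fp FN; rewrite (bigID (fun i => (i < N)%N)) /= addrC big1 ?add0r; last first.
  by move=> i; rewrite -leqNgt => /FN.
rewrite -(big_mkord xpredT) /index_iota subn0 [RHS](bigID (fun i => i \in msupp p)) /=.
rewrite [X in _ = _ + X]big1 ?addr0 => [|i /mcoeff_outdom/Fp//].
rewrite -big_filter -[RHS]big_filter; apply: perm_big; apply: uniq_perm.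
- exact/filter_uniq/fset_uniq.
- exact/filter_uniq/iota_uniq.
by move=> i; rewrite !mem_filter mem_iota /= add0n andbC.
Qed.

Lemma vpoly_bounded p : exists N, forall i, (N <= i)%N -> p@_i = 0.
Proof.
exists (\max_(i <- msupp p) i).+1 => i Ni; apply: mcoeff_outdom.
by apply/negP => ip; move: Ni; rewrite ltnNge (@leq_bigmax_seq _ _ xpredT (fun k : nat => k) i).
Qed.

Lemma veval_sum p a N : (forall i, (N <= i)%N -> p@_i = 0) ->
  veval p a = \sum_(i < N) a ^+ i *: p@_(i : nat).
Proof.
by move=> pN; apply: (sum_msupp (F := fun i => a ^+ i *: p@_i)) => i => [->|/pN ->]; rewrite scaler0.
Qed.

Lemma coef_sum_eq0 N (u : nat -> K) :
  (forall a, \sum_(i < N) a ^+ i * u i = 0) -> forall i, (i < N)%N -> u i = 0.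
Proof.
move=> u0 i iN; pose q := \poly_(i < N) u i.
suff q0 : q = 0 by have := coef_poly N u i; rewrite -/q q0 coef0 iN.
apply/eqP; apply: contraT => qn0.
have := @max_poly_roots _ q [seq k%:R | k <- iota 0 N] qn0.
have -> : all (root q) [seq k%:R | k <- iota 0 N].
  apply/allP => a _; apply/rootP; rewrite horner_poly -[RHS](u0 a).
  by apply: eq_bigr => j _; rewrite mulrC.
rewrite map_inj_uniq ?iota_uniq; last by move=> j k /eqP; rewrite eqr_nat => /eqP.
by move=> /(_ isT isT); rewrite size_map size_iota ltnNge size_poly.
Qed.

(** Lets the span of values be handled as a span of coefficients. Coordinates of the component
    outside [W] reduce the claim to scalar polynomials, which vanish when they have too many
    roots. *)
Lemma veval_coef p W : (forall a, veval p a \in W) <-> (forall i, p@_i \in W).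
Proof.
have [N pN] := vpoly_bounded p; split=> [pW i|pW a]; last first.
  by rewrite (veval_sum _ pN); apply: memv_suml => i _; rewrite memvZ.
pose q := (\1 - projv W)%VF.
have qW x : (q x == 0) = (x \in W).
  rewrite add_lfunE opp_lfunE id_lfunE subr_eq0; apply/eqP/idP => [->|xW].
    exact: memv_proj.
  by rewrite projv_id.
have [iN|/pN ->] := ltnP i N; last exact: mem0v.
rewrite -qW (coord_vbasis (memvf (q p@_i))) big1 // => j _.
rewrite (@coef_sum_eq0 N (fun i => coord (vbasis fullv) j (q p@_i))) ?scale0r // => a.
have /eqP := pW a; rewrite eqb_id -qW (veval_sum _ pN) => /eqP.
rewrite linear_sum => /(congr1 (coord (vbasis fullv) j)); rewrite linear0 linear_sum /=.
move=> sum0; rewrite -[RHS]sum0.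
by apply: eq_bigr => k _; rewrite !linearZ.
Qed.

Lemma mcoeff_vsubst_add p i j :
  (vsubst_add p)@_(i, j) = p@_(i + j) *+ 'C(i + j, i).
Proof.
rewrite /vsubst_add raddf_sum /=.
under eq_bigr => n _ do rewrite raddf_sum /=.
transitivity (\sum_(n <- msupp p) (p@_n *+ 'C(n, i)) *+ (n == (i + j)%N)).
  apply: eq_bigr => n _.
  under eq_bigr => k _ do rewrite mcoeffU.
  have [->|nij] := eqVneq n (i + j)%N.
    have iij : (i < (i + j).+1)%N by rewrite ltnS leq_addr.
    rewrite (bigD1 (Ordinal iij)) //= addKn eqxx big1 ?addr0 // => k kneq.
    case: eqP => // -[ki _]; case/eqP: kneq; exact/val_inj.
  rewrite big1 // => k _; case: eqP => // -[ki kj].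
  by case/eqP: nij; rewrite -ki -kj subnKC // -ltnS ltn_ord.
rewrite (@sum_msupp p (fun n => (p@_n *+ 'C(n, i)) *+ (n == (i + j)%N)) (i + j).+1).
- rewrite big_ord_recr /= eqxx big1 ?add0r // => k _.
  by rewrite ltn_eqF ?ltn_ord.
- by move=> n ->; rewrite !mul0rn.
- by move=> n ijn; rewrite gtn_eqF.
Qed.

Lemma mcoeff_vmulXl i (p : vpoly2 V) k j :
  (vmulXl i p)@_(k, j) = if (i <= k)%N then p@_(k - i, j)%N else 0.
Proof.
rewrite /vmulXl raddf_sum /=.
under eq_bigr => m _ do rewrite mcoeffU.
have [ik|ki] := leqP i k; last first.
  rewrite big1 // => -[m1 m2] _; case: eqP => // -[E _].
  by move: ki; rewrite -E ltnNge leq_addr.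
have [kp|kp] := boolP ((k - i, j)%N \in msupp p).
  rewrite (big_fsetD1 _ kp) /= subnKC // eqxx big1_fset ?addr0 // => -[m1 m2].
  rewrite in_fsetD1 => /andP[mk _] _; case: eqP => // -[E1 E2].
  by case/eqP: mk; rewrite -E1 -E2 addKn.
rewrite mcoeff_outdom // big1_fset // => -[m1 m2] mp _.
case: eqP => // -[E1 E2]; case/negP: kp.
by rewrite -E1 -E2 addKn.
Qed.

Lemma msupp_pick p (F : nat -> V) k : (p@_k = 0 -> F k = 0) ->
  \sum_(i <- msupp p) F i *+ (i == k) = F k.
Proof.
move=> Fk; rewrite (@sum_msupp p (fun i => F i *+ (i == k)) k.+1).
- rewrite big_ord_recr /= eqxx big1 ?add0r // => i _.
  by rewrite ltn_eqF ?ltn_ord.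
- by move=> i; case: eqP => [->|]; rewrite ?mulr0n.
- by move=> i ki; rewrite gtn_eqF.
Qed.

End Coefficients.

(** * The averaging identity in coefficients *)

Section Averaging.
Context (K : numClosedFieldType) (g : vectLieType K) (T : {linear g -> vpoly1 g}).
Implicit Types (x y : g) (A B W : {vspace g}).

Definition tcoef m x : g := (T x)@_m.

Lemma tcoef_linear m : linear (tcoef m).
Proof.
by move=> k x y; rewrite /tcoef linearP /= mcoeffD mcoeff_vpolyZ.
Qed.

HB.instance Definition _ m := GRing.isLinear.Build K g g _ (tcoef m) (tcoef_linear m).

Lemma tcoef_Tstar B m x : x \in B -> tcoef m x \in Tstar T B.
Proof.
move=> xB; apply: (veval_coef (T x) _).1 => k.
by apply: mem_lspan; exists k, x.
Qed.

Lemma Tstar_sub B W : (forall m x, x \in B -> tcoef m x \in W) -> (Tstar T B <= W)%VS.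
Proof.
move=> BW; apply/lspan_subvP => _ [k [x [xB ->]]].
by apply: (veval_coef (T x) _).2 => m; apply: BW.
Qed.

Lemma tcoef_bounded : exists N, forall m, (N <= m)%N -> forall x, tcoef m x = 0.
Proof.
have [N sN] : exists N, forall m, (N <= m)%N ->
    forall x, x \in (vbasis {:g} : seq g) -> tcoef m x = 0.
  elim: (vbasis {:g} : seq g) => [|v s [N sN]]; first by exists 0%N.
  have [M vM] := vpoly_bounded (T v); exists (maxn M N) => m.
  rewrite geq_max => /andP[Mm Nm] x; rewrite inE => /orP[/eqP->|]; last exact: sN.
  exact: vM.
exists N => m Nm x; rewrite (coord_vbasis (memvf x)) linear_sum big1 // => i _.
by rewrite /= linearZ /= sN ?scaler0 // mem_nth // size_tuple.
Qed.

(** Compare coefficients of lambda^p mu^j: in lambda^i (lambda + mu)^n this monomial occurs only for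
    i <= p and n = p - i + j, with a binomial factor. *)
Lemma averaging_coef : conformal_averaging T -> forall p j x y,
  br (tcoef p x) (tcoef j y) = \sum_(i < p.+1)
    tcoef (p - i + j)%N (br (tcoef i x) y) *+ 'C(p - i + j, p - i).
Proof.
move=> cT p j x y; have := congr1 (mcoeff (p, j)) (cT x y).
rewrite !raddf_sum /=.
under eq_bigr => i _ do rewrite mcoeff_vmulXl mcoeff_vsubst_add.
under [in RHS]eq_bigr => i _ do rewrite raddf_sum /=.
pose F i : g := if (i <= p)%N then
  tcoef (p - i + j)%N (br (tcoef i x) y) *+ 'C(p - i + j, p - i) else 0.
have F0 i : (T x)@_i = 0 -> F i = 0.
  by move=> xi; rewrite /F /tcoef xi br0l; case: ifP; rewrite // linear0 mcoeff0 mul0rn.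
have FN i : (p.+1 <= i)%N -> F i = 0 by move=> pi; rewrite /F leqNgt pi.
rewrite -/F => LR; transitivity (\sum_(i <- msupp (T x)) F i); last first.
  rewrite (sum_msupp F0 FN); apply: eq_bigr => i _.
  by rewrite /F -ltnS ltn_ord.
transitivity (\sum_(i <- msupp (T x)) \sum_(k <- msupp (T y))
    (<< lie (T x)@_i (T y)@_k *g (i, k) >> : vpoly2 g)@_(p, j)); last first.
  by rewrite -LR.
transitivity (\sum_(i <- msupp (T x)) br (tcoef i x) (tcoef j y) *+ (i == p)).
  rewrite (msupp_pick (F := fun i => br (tcoef i x) (tcoef j y))) // => xp.
  by rewrite /tcoef xp br0l.
apply: eq_bigr => i _; under [RHS]eq_bigr => k _ do rewrite mcoeffU xpair_eqE.
have [->|_] /= := eqVneq i p; last by rewrite mulr0n big1.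
rewrite (msupp_pick (F := fun k => br (tcoef p x) (tcoef k y))) // => yj.
by rewrite /tcoef yj br0r.
Qed.

End Averaging.

(** * Homogeneous conformal averaging operators *)

Section Homogeneous.
Context (K : numClosedFieldType) (g : vectLieType K) (H : {vspace g}) (h0 : g).
Context (T : {linear g -> vpoly1 g}).
Hypothesis rd : root_data H h0.
Hypothesis nondeg : forall x : g, (forall y, killing x y = 0) -> x = 0.
Hypothesis conf : conformal_averaging T.
Local Notation A := (Tstar T {:g}%VS).
Hypothesis HA : (H <= A)%VS.
Implicit Types (x y z h e f : g) (I J U V W : {vspace g}) (b c d : K).

Local Notation E := (geig (ad h0)).
Local Notation a c := (wt (E c)).
Local Notation t := (tcoef T).

Lemma base_mem_cartan : h0 \in H. Proof. exact: rd_mem rd. Qed.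
Lemma base_mem_Tstar : h0 \in A. Proof. exact: (subvP HA) base_mem_cartan. Qed.

Lemma tcoefB m x y : t m (x - y) = t m x - t m y. Proof. exact: linearB. Qed.
Lemma tcoefN m x : t m (- x) = - t m x. Proof. exact: linearN. Qed.
Lemma tcoefZ m k x : t m (k *: x) = k *: t m x. Proof. exact: linearZ. Qed.

Lemma tcoef_mem m x : t m x \in A. Proof. exact/tcoef_Tstar/memvf. Qed.

Lemma Tstar_full_sub W : (forall m x, t m x \in W) -> (A <= W)%VS.
Proof. by move=> tW; apply: Tstar_sub => m x _; apply: tW. Qed.

Lemma Tstar_full_ind W x : (forall m y, t m y \in W) -> x \in A -> x \in W.
Proof. by move=> /Tstar_full_sub/subvP; apply. Qed.

Lemma Tstar_full_br x y : x \in A -> y \in A -> br x y \in A.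
Proof.
move=> xA; rewrite -adE memv_preim; apply: Tstar_full_ind => j y'.
rewrite -memv_preim adE br_anti memvN -adE memv_preim; move: xA; apply: Tstar_full_ind => m x'.
rewrite -memv_preim adE br_anti memvN averaging_coef //.
by apply: memv_suml => i _; rewrite rpredMn ?tcoef_mem.
Qed.

Lemma Tstar_full_stable : stablev (ad h0) A.
Proof. by move=> x xA; rewrite adE Tstar_full_br ?base_mem_Tstar. Qed.

Lemma Tstar_full_graded W x : (forall c y, y \in A -> y \in E c -> y \in W) -> x \in A -> x \in W.
Proof.
move=> AW; apply/subvP; apply: graded_sub Tstar_full_stable _ => c; apply/subvP => y.
by rewrite memv_cap => /andP[]; apply: AW.
Qed.

Lemma full_graded W x : (forall c y, y \in E c -> y \in W) -> x \in W.
Proof.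
move=> EW; apply: (subvP _ _ (memvf x)).
apply: (graded_sub (h0 := h0)) => [z _|c]; first exact: memvf.
by rewrite capfv; apply/subvP => y; apply: EW.
Qed.

Lemma tcoef_comm_geig m c x : (forall y, br h0 (t m y) = t m (br h0 y)) ->
  x \in E c -> t m x \in E c.
Proof.
move=> comm /mem_geig[n xn]; apply/mem_geig; exists n.
have sh y : (ad h0 - c *: \1%VF)%VF (t m y) = t m ((ad h0 - c *: \1%VF)%VF y).
  by rewrite !shiftE !adE comm tcoefB tcoefZ.
have -> : iter n (ad h0 - c *: \1%VF)%VF (t m x) = t m (iter n (ad h0 - c *: \1%VF)%VF x).
  by elim: n {xn} => //= n ->.
by rewrite xn linear0.
Qed.

(** The invariant carried by the descending induction on m. *)
Definition central_coef m := (forall x, t m x \in H) /\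
  (forall x y, x \in A -> br x (t m y) = 0 /\ t m (br x y) = 0).

(** In the identity for [t_p z, t_m y] the terms with i < p involve t_k [A, g] for some k > m, which
    is 0. Only t_m [t_p z, y] remains, and the t_p z span A. *)
Lemma coef_comm m : (forall k, (m < k)%N -> central_coef k) ->
  forall x y, x \in A -> br x (t m y) = t m (br x y).
Proof.
move=> cen x y xA.
pose W := lker (ad (t m y) - (linfun (t m) \o ad y)%VF).
have memW z : z \in W <-> br z (t m y) = t m (br z y).
  rewrite br_anti [br z y]br_anti tcoefN; split=> [/eqlfunP|/oppr_inj zE].
    by rewrite comp_lfunE [linfun (t m) _]lfunE /= !adE => ->.
  by apply/eqlfunP; rewrite comp_lfunE [linfun (t m) _]lfunE /= !adE.
apply/memW; move: xA; apply: Tstar_full_ind => p z; apply/memW.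
rewrite averaging_coef // big_ord_recr /= subnn add0n bin0 mulr1n big1 ?add0r // => i _.
have pim : (m < p - i + m)%N by rewrite -[X in (X < _)%N]add0n ltn_add2r subn_gt0.
by rewrite ((cen _ pim).2 _ y (tcoef_mem i z)).2 mul0rn.
Qed.

Lemma coef_sq m x y : (0 < m)%N -> (forall k, (m < k)%N -> central_coef k) ->
  y \in A -> t m (br (t m x) y) = 0.
Proof.
case: m => // m _ cen yA.
have cenA z : br (t m.+2 z) y = 0.
  by rewrite br_anti ((cen _ (ltnSn _)).2 y z yA).1 oppr0.
(* After the case split the index of the statement is [m.+1]. The left side and the last term vanish
   since [t m.+2 x] is centralized by A, the terms i <= m vanish by [cen], and i = m+1 leaves (m+1)
   times the claim. *)
have := averaging_coef conf m.+2 m x y.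
rewrite br_anti ((cen _ (ltnSn _)).2 _ x (tcoef_mem m y)).1 oppr0.
rewrite big_ord_recr /= cenA linear0 mul0rn addr0.
rewrite big_ord_recr /= subSnn add1n bin1 big1 ?add0r => [|i _]; last first.
  have im : (m.+1 < m.+2 - i + m)%N.
    by rewrite -[X in (X < _)%N]add1n ltn_add2r ltn_subRL addn1 ltnS ltn_ord.
  by rewrite ((cen _ im).2 _ y (tcoef_mem i x)).2 mul0rn.
move/esym/eqP; rewrite -scaler_nat scaler_eq0 pnatr_eq0 /= => /eqP //.
Qed.

Lemma coef_central m : (0 < m)%N -> central_coef m.
Proof.
have [N tN] := tcoef_bounded T.
suff key k n : (0 < n)%N -> (N <= n + k)%N -> central_coef n.
  by move=> m0; apply: (key N) => //; rewrite leq_addl.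
elim: k n => [|k IHk] n n0 nN.
  rewrite addn0 in nN; split=> [x|x y _]; first by rewrite tN // mem0v.
  by rewrite !tN // br0r.
have cen j : (n < j)%N -> central_coef j.
  move=> nj; apply: IHk; first exact: leq_trans nj.
  by apply: leq_trans nN _; rewrite addnS -addSn leq_add2r.
have comm := coef_comm cen.
have stE c x : x \in E c -> t n x \in E c.
  by apply: tcoef_comm_geig => y; apply: comm base_mem_Tstar.
(* On the line E c, t_n is a scalar s, and [coef_sq] with y = h0 reads - c s^2 x = 0. *)
have tE c x : c != 0 -> x \in E c -> t n x = 0.
  move=> c0 xc; have [->|x0] := eqVneq x 0; first by rewrite linear0.
  have /vlineP[s sx] : t n x \in <[x]>%VS.
    by rewrite -(root_line rd nondeg c0 xc x0) stE.
  have := coef_sq x n0 cen base_mem_Tstar.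
  have Ec : E c != 0%VS by apply: contraNneq x0 => E0; rewrite -memv0 -E0.
  rewrite sx brZl br_anti (root_eigen rd nondeg c0 xc base_mem_cartan) (root_wt_h0 rd Ec).
  rewrite scalerN -scaleNr !tcoefZ sx !scalerA => /eqP.
  rewrite scaler_eq0 (negPf x0) orbF !mulf_eq0 oppr_eq0 (negPf c0) orbF orbb => /eqP->.
  by rewrite scale0r.
have tH x : t n x \in H.
  rewrite -[t n x]lfunE memv_preim; apply: full_graded => c y yc; rewrite -memv_preim lfunE /=.
  have [c0|c0] := eqVneq c 0; last by rewrite (tE c) // mem0v.
  by rewrite -(root_E0 rd) stE // -c0.
split=> // x y xA; rewrite -(comm x y xA); suff -> : br x (t n y) = 0 by [].
suff : x \in lker (ad (t n y)) by rewrite memv_ker adE br_anti oppr_eq0 => /eqP.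
move: xA; apply: Tstar_full_graded => c z zA zc; rewrite memv_ker adE br_anti oppr_eq0.
have [c0|c0] := eqVneq c 0.
  by rewrite (cartan_abelian rd nondeg) // -(root_E0 rd) -c0.
(* The bracket [z, t_n y] lies in E c because t_n y is in H, and in H because it equals t_n
   [z, y]. *)
apply/eqP; apply: (geig_disjoint (f := ad h0) c0).
  by rewrite -[c]addr0; apply: root_shift => //; rewrite (root_E0 rd).
by rewrite comm // (root_E0 rd).
Qed.

Lemma coef0_comm x y : x \in A -> br x (t 0 y) = t 0 (br x y).
Proof. by apply: coef_comm => k; apply: coef_central. Qed.

Lemma coef0_E c x : x \in E c -> t 0 x \in E c.
Proof. by apply: tcoef_comm_geig => y; apply: coef0_comm base_mem_Tstar. Qed.

(** A is spanned by the values of the t_m. Those with m > 0 lie in H and t_0 preserves each E d, so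
    if t_0 killed the line E c, all of A would lie in the sum of the other E d. *)
Lemma coef0_neq0 c e : c != 0 -> e \in A -> e \in E c -> e != 0 -> t 0 e != 0.
Proof.
move=> c0 eA ec e0; have := e0; apply: contra_neq => te0.
have [s us [out _]] := spectrum_exists (ad h0).
apply: (@geig_sum_disjoint _ _ (ad h0) [seq d <- s | d != c] c) => //.
- exact: filter_uniq.
- by rewrite mem_filter eqxx.
set W := (\sum_(d <- _) _)%VS.
have EW d : d != c -> (E d <= W)%VS.
  move=> dc; have [ds|/out ->] := boolP (d \in s); last exact: sub0v.
  by apply: (subv_sum_mem E); rewrite mem_filter dc.
move: eA; apply: Tstar_full_ind => -[|m] x; last first.
  have := (@coef_central m.+1 isT).1 x; rewrite -(root_E0 rd); apply/subvP/EW.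
  by rewrite eq_sym.
rewrite -[t 0 x]lfunE memv_preim; apply: full_graded => d y yd; rewrite -memv_preim lfunE /=.
have [dc|dc] := eqVneq d c; last by apply: (subvP (EW d dc)); apply: coef0_E.
have /vlineP[k ->] : y \in <[e]>%VS by rewrite -(root_line rd nondeg c0 ec e0) -dc.
by rewrite tcoefZ te0 scaler0 mem0v.
Qed.

(** Let f span E(-c) and h = [e, f]. If t_0 f is nonzero, this line lies in A. Otherwise t_0 h =
    [e, t_0 f] = 0, so 0 = [e, t_0 h] = t_0 [e, h] = - a_c(h) t_0 e, although a_c(h) and t_0 e are
    nonzero. *)
Lemma Tstar_full_opp c e : c != 0 -> e \in A -> e \in E c -> e != 0 -> (E (- c) <= A)%VS.
Proof.
move=> c0 eA ec e0; have mc0 : - c != 0 by rewrite oppr_eq0.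
have Ec : E c != 0%VS by apply: contraNneq e0 => E0; rewrite -memv0 -E0.
have [_ Emc] := root_dim1 rd nondeg c0 Ec.
set f := vpick (E (- c)); have fc : f \in E (- c) by apply: memv_pick.
have f0 : f != 0 by rewrite vpick0.
have tfc := coef0_E fc.
have [tf0|tf0] := eqVneq (t 0 f) 0; last first.
  by rewrite (root_line rd nondeg mc0 tfc tf0) -memvE tcoef_mem.
have := coef0_neq0 c0 eA ec e0.
set h := br e f; have hH : h \in H.
  by rewrite -(root_E0 rd) -(subrr c); apply: root_shift.
have th : t 0 h = 0 by rewrite -coef0_comm // tf0 br0r.
have := coef0_comm h eA; rewrite th br0r br_anti (root_eigen rd nondeg c0 ec hH).
move/esym/eqP; rewrite tcoefN oppr_eq0 tcoefZ scaler_eq0.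
by rewrite (negPf (root_coroot rd nondeg c0 ec fc e0 f0)) /= => ->.
Qed.

(** The radical of the restricted form is graded. A homogeneous nonzero element of it in E c would
    be orthogonal to E(-c), which lies in A. *)
Lemma killing_Tstar_nondeg x : x \in A -> (forall y, y \in A -> killing x y = 0) -> x = 0.
Proof.
move=> xA xk.
pose R := lspan [set z | z \in A /\ forall y, y \in A -> killing z y = 0].
have memR z : z \in R <-> z \in A /\ forall y, y \in A -> killing z y = 0.
  apply: (mem_lspan_closed (S := [set z | z \in A /\ forall y, y \in A -> killing z y = 0])) => /=.
    by split=> [|y _]; rewrite ?mem0v // killingC linear0.
  move=> k u w [uA u0] [wA w0]; split=> [|y yA]; first by rewrite memvD ?memvZ.
  by rewrite killingC linearP /= ![killing y _]killingC u0 ?w0 // mulr0 addr0.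
apply/eqP; rewrite -memv0; apply: (subvP _ _ ((memR x).2 (conj xA xk))).
apply: (graded_sub (h0 := h0)) => [z /memR[zA zk]|c].
  apply/memR; split=> [|y yA]; first exact: Tstar_full_stable.
  by rewrite adE br_anti -scaleN1r killingC linearZ /= killingC killing_inv zk ?mulr0 // Tstar_full_br ?base_mem_Tstar.
apply/subvP => z; rewrite memv_cap memv0 => /andP[/memR[zA zk] zc].
apply/eqP; have [//|z0] := eqVneq z 0.
apply: (killing_opp nondeg zc) => y yc; apply: zk.
have [c0|c0] := eqVneq c 0; last exact: (subvP (Tstar_full_opp c0 zA zc z0)).
by apply: (subvP HA); rewrite -(root_E0 rd) -[0]oppr0 -c0.
Qed.

Local Notation Z := (lie_center A).
Local Notation G := (lie_span A A).

Lemma mem_center_br z : z \in Z <-> z \in A /\ forall x, x \in A -> br z x = 0.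
Proof. exact: mem_lie_center. Qed.

(** Otherwise the ideal contains e, an opposite root vector f and h = [e, f]. These span a copy of
    sl_2, which survives in every term of the derived series. *)
Lemma ideal_no_root I c e : lie_ideal A I -> lie_solvable I -> c != 0 ->
  e \in I -> e \in E c -> e = 0.
Proof.
move=> [IA iI] [n In] c0 eI ec; apply/eqP; apply: contraT => e0.
have eA := subvP IA e eI; have mc0 : - c != 0 by rewrite oppr_eq0.
have Ec : E c != 0%VS by apply: contraNneq e0 => E0; rewrite -memv0 -E0.
have [_ Emc] := root_dim1 rd nondeg c0 Ec.
set f := vpick (E (- c)); have fc : f \in E (- c) by apply: memv_pick.
have f0 : f != 0 by rewrite vpick0.
have fA : f \in A by apply: (subvP (Tstar_full_opp c0 eA ec e0)).
set h := br e f; have hH : h \in H.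
  by rewrite -(root_E0 rd) -(subrr c); apply: root_shift.
have hI : h \in I by rewrite /h br_anti memvN; apply: iI.
have he : br h e = a c h *: e by apply: (root_eigen rd nondeg).
have hf : br h f = a (- c) h *: f by apply: (root_eigen rd nondeg).
have ac : a c h != 0 by apply: (root_coroot rd nondeg).
have amc : a (- c) h != 0.
  have := root_coroot rd nondeg mc0 fc; rewrite opprK => /(_ e ec f0 e0).
  by rewrite br_anti linearN oppr_eq0.
have divI k x U : k != 0 -> k *: x \in U -> x \in U.
  by move=> k0 /(memvZ k^-1); rewrite scalerA mulVf // scale1r.
have fI : f \in I.
  by apply: (divI _ _ _ amc); rewrite -hf br_anti memvN; apply: iI.
have : [/\ e \in derived_series n I, f \in derived_series n I & h \in derived_series n I].
  elim: n {In} => //= n [eD fD hD]; split; last exact: mem_lie_span.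
    by apply: (divI _ _ _ ac); rewrite -he; apply: mem_lie_span.
  by apply: (divI _ _ _ amc); rewrite -hf; apply: mem_lie_span.
by rewrite In memv0 (negPf e0) => -[].
Qed.

(** Being graded without root vectors, the ideal lies in H; its brackets with root vectors in E c
    then lie both in E c and in H. *)
Lemma solvable_ideal_central I : lie_ideal A I -> lie_solvable I -> (I <= Z)%VS.
Proof.
move=> iI sI; have [IA Iid] := iI.
have IH : (I <= H)%VS.
  apply: (graded_sub (h0 := h0)) => [x xI|c]; first by rewrite adE; apply: Iid base_mem_Tstar xI.
  apply/subvP => x; rewrite memv_cap => /andP[xI xc].
  have [c0|c0] := eqVneq c 0; first by rewrite -(root_E0 rd) -c0.
  by rewrite (ideal_no_root iI sI c0 xI xc) mem0v.
apply/subvP => z zI; have zH := subvP IH z zI.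
apply/mem_center_br; split=> [|x xA]; first exact: (subvP IA).
suff : x \in lker (ad z) by rewrite memv_ker adE => /eqP.
move: xA; apply: Tstar_full_graded => c y yA yc; rewrite memv_ker adE.
have [c0|c0] := eqVneq c 0.
  by rewrite (cartan_abelian rd nondeg) // -(root_E0 rd) -c0.
apply/eqP; apply: (geig_disjoint (f := ad h0) c0).
  by rewrite -[c]add0r; apply: root_shift => //; rewrite (root_E0 rd).
by rewrite (root_E0 rd) br_anti memvN; apply: (subvP IH); apply: Iid.
Qed.

Lemma derived_sub : (G <= A)%VS.
Proof. by apply: lie_span_sub => x y; apply: Tstar_full_br. Qed.

(** For h central and in [A, A], every eigenvalue of [ad h] on [g] is a normalized trace of
    commutators, hence 0. So [ad h] is nilpotent and commutes with [ad A], which makes h orthogonal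
    to A. *)
Lemma derived_center_disjoint : (G :&: Z = 0)%VS.
Proof.
apply/eqP; rewrite -subv0; apply/subvP => h; rewrite memv_cap memv0.
move=> /andP[hG /mem_center_br[hA hcen]]; apply/eqP; apply: killing_Tstar_nondeg => // x xA.
have comm v : br h (br x v) = br x (br h v) by rewrite br_der hcen // br0l add0r.
have geig0 c : geig (ad h) c != 0%VS -> c = 0.
  set U := geig (ad h) c => U0.
  have stU y : y \in A -> stablev (ad y) U.
    move=> yA u uU; rewrite adE /U -[X in geig _ X]add0r; apply: geig_lie => //.
    by apply/mem_geig0; exists 1%N; rewrite /= adE hcen.
  (* [U] is an [A]-module because [h] is central, and [h] is a sum of brackets. *)
  have -> : c = wt U h by apply: wt_geig => //; apply: stU.
  pose P := lspan [set y | wt U y = 0].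
  have memP y : y \in P <-> wt U y = 0.
    apply: (mem_lspan_closed (S := [set y | wt U y = 0])) => /=; first exact: linear0.
    by move=> k u w u0 w0; rewrite linearP /= u0 w0 mulr0 addr0.
  apply/memP; apply: (subvP _ _ hG); apply: lie_span_sub => y z yA zA.
  by apply/memP; rewrite /wt ad_lie trv_comm ?mul0r //; apply: stU.
apply: killing_nilp => v.
have [s us [out /(_ fullv) sV]] := spectrum_exists (ad h).
have : v \in geig (ad h) 0.
  apply: (subvP _ _ (memvf v)); apply: subv_trans (sV _) (sum_subvP _).
    by move=> y _; apply: memvf.
  move=> c _; rewrite capfv; have [->|/geig0 ->] := eqVneq (geig (ad h) c) 0%VS => //.
  exact: sub0v.
move=> /mem_geig0[n vn]; exists n.
have -> : iter n (ad h \o ad x)%VF v = iter n (ad x) (iter n (ad h) v).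
  elim: n {vn} => //= n ->; rewrite comp_lfunE -[RHS]iterS iterSr.
  have -> : ad h (ad x (iter n (ad x) (iter n (ad h) v)))
     = ad h (iter n.+1 (ad x) (iter n (ad h) v)) by [].
  rewrite iter_comm => [|y]; last by rewrite !adE.
  by rewrite -iterSr.
by rewrite vn iter_lfun0.
Qed.

(** The values are retyped in the vector space [K^o] so that [linfun] and [lker] apply. *)
Definition killing_r x y : K^o := killing x y.

Lemma killing_r_linear x : linear (killing_r x).
Proof. by move=> k y z; rewrite /killing_r linearP. Qed.

HB.instance Definition _ x := GRing.isLinear.Build K g K^o _ (killing_r x) (killing_r_linear x).

Lemma dim_perp (s : seq g) U : exists2 W : {vspace g}, (\dim U <= \dim W + size s)%N &
  (W <= U)%VS /\ forall x y, x \in W -> y \in s -> killing y x = 0.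
Proof.
elim: s => [|v s [W dW [WU Ws]]]; first by exists U; rewrite ?addn0.
pose phi : 'Hom(g, K^o) := linfun (killing_r v).
exists (W :&: lker phi)%VS.
  apply: leq_trans dW _; rewrite -(limg_ker_dim phi W) /= -addnA leq_add2l -add1n leq_add2r.
  by apply: leq_trans (dimvS (subvf _)) _; rewrite dimvf.
split; first exact: subv_trans (capvSl _ _) WU.
move=> x y; rewrite memv_cap memv_ker lfunE => /andP[xW /eqP vx].
by rewrite inE => /orP[/eqP->//|]; apply: Ws.
Qed.

(** The orthogonal of [A, A] in A has dimension at least dim A - dim [A, A]. It is central, since
    killing [x, y] z = killing x [y, z] = 0 for all y, z in A. *)
Lemma Tstar_full_decomp : A = (G + Z)%VS.
Proof.
have ZA : (Z <= A)%VS by apply/subvP => z /mem_center_br[].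
apply/eqP; rewrite eq_sym eqEdim subv_add derived_sub ZA /= (dimv_disjoint_sum derived_center_disjoint).
have [W dW [WA Wk]] := dim_perp (vbasis G) A.
rewrite size_tuple addnC in dW; apply: leq_trans dW _; rewrite leq_add2l; apply: dimvS.
apply/subvP => x xW; have xA := subvP WA x xW; apply/mem_center_br; split=> // y yA.
apply: killing_Tstar_nondeg; first exact: Tstar_full_br.
move=> z zA; rewrite killing_inv; apply/mem_kperp.
have : br y z \in G by apply: mem_lie_span.
rewrite -{1}(span_basis (vbasisP G)); apply: (subvP _ _); apply/span_subvP => w ws.
by apply/mem_kperp; rewrite killingC; apply: Wk.
Qed.

(** As A = [A, A] + Z and Z acts trivially, an ideal of [A, A] is an ideal of A; if solvable, it
    lies in the zero intersection of [A, A] and Z. *)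
Lemma derived_semisimple : lie_semisimple G.
Proof.
split.
  by move=> x y xG yG; apply: mem_lie_span; apply: (subvP derived_sub).
move=> J [JG iJ] sJ; apply/eqP; rewrite -subv0 -derived_center_disjoint subv_cap JG /=.
apply: solvable_ideal_central => //; split; first exact: subv_trans derived_sub.
move=> x y xA yJ; move: xA; rewrite Tstar_full_decomp => /memv_addP[u uG [z /mem_center_br[_ zc] ->]].
rewrite -/(br _ _) brDl zc ?addr0; first exact: iJ.
exact/(subvP derived_sub)/(subvP JG).
Qed.

(** A root vector of A is a multiple of its image under t_0. For opposite roots write x = k t_0 x,
    so that [y, x] = k t_0 [y, x] with [y, x] in A. *)
Lemma derived_sub_TstarTstar : (G <= Tstar T A)%VS.
Proof.
have rootT c x : c != 0 -> x \in A -> x \in E c -> x \in Tstar T A.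
  move=> c0 xA xc; have [->|x0] := eqVneq x 0; first exact: mem0v.
  have tx0 := coef0_neq0 c0 xA xc x0; have txc := coef0_E xc.
  have /vlineP[k ->] : x \in <[t 0%N x]>%VS by rewrite -(root_line rd nondeg c0 txc tx0).
  by rewrite memvZ // tcoef_Tstar.
apply: lie_span_sub => x y xA yA.
rewrite -adE memv_preim; move: yA; apply: Tstar_full_graded => d y' yA yd.
rewrite -memv_preim adE br_anti memvN -adE memv_preim; move: xA.
apply: Tstar_full_graded => c x' xA xc; rewrite -memv_preim adE.
have [dc0|dc0] := eqVneq (d + c) 0; last first.
  by apply: (rootT _ _ dc0); [apply: Tstar_full_br|apply: root_shift].
have cE : c = - d by apply/eqP; rewrite -addr_eq0 addrC dc0.
have [d0|d0] := eqVneq d 0.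
  rewrite (cartan_abelian rd nondeg) ?mem0v // -(root_E0 rd) -?d0 //.
  by rewrite d0 -[0]oppr0 -d0 -cE.
have c0 : c != 0 by rewrite cE oppr_eq0.
have [->|x0] := eqVneq x' 0; first by rewrite br0r mem0v.
have tx0 := coef0_neq0 c0 xA xc x0; have txc := coef0_E xc.
have /vlineP[k ->] : x' \in <[t 0%N x']>%VS by rewrite -(root_line rd nondeg c0 txc tx0).
by rewrite brZr memvZ // coef0_comm // tcoef_Tstar // Tstar_full_br.
Qed.

End Homogeneous.

Theorem theorem2 (R : realType) (g : vectLieType R[i])
    (T : {linear g -> vpoly1 g}) :
  lie_semisimple {:g}%VS ->
  conformal_averaging T ->
  homogeneous T ->
  lie_reductive (Tstar T {:g}%VS) /\
  exists g0 : {vspace g},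
    [/\ lie_semisimple g0,
        Tstar T {:g}%VS = (g0 + lie_center (Tstar T {:g}%VS))%VS,
        directv (g0 + lie_center (Tstar T {:g}%VS))%VS
      & (g0 <= Tstar T (Tstar T {:g}%VS))%VS].
Proof.
move=> ss conf [H cH HA].
have [h0 rd] := @cartan_root_data R[i] g H cH.
have nondeg := @killing_nondeg R[i] g H h0 rd ss.
split.
  split; first by move=> x y; apply: (Tstar_full_br conf).
  by move=> I; apply: (solvable_ideal_central rd nondeg conf HA).
exists (lie_span (Tstar T {:g}%VS) (Tstar T {:g}%VS)); split.
- exact: (derived_semisimple rd nondeg conf HA).
- exact: (Tstar_full_decomp rd nondeg conf HA).
- by apply/directv_addP; apply: (derived_center_disjoint rd nondeg conf HA).
- exact: (derived_sub_TstarTstar rd nondeg conf HA).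
Qed.
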